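(* Let $Z$ be a $*$-TRO, and let $\theta:Z\to B$ be a positive ternary $*$-morphism into a C*-algebra $B$. Then: 1) $\theta$ is completely positive. 2) $\theta$ restricts to a $*$-homomorphism from $J(Z)=Z\cap Z^2$ into $B$. Indeed if $\pi:Z^2\to B$ is the $*$-homomorphism canonically associated with $\theta$, determined by $\pi(x^*y)=\theta(x)^*\theta(y)$ for $x,y\in Z$, then $\theta=\pi$ on $J(Z)$. 3) If $A=Z+Z^2$, then $\theta$ is the restriction to $Z$ of a $*$-homomorphism from $A$ into $B$. Hence $\theta$ may be extended further to a unital $*$-homomorphism from a unitization of $A$ into a unitization of $B$. 4) If $\theta$ is an order embedding then it is a complete order embedding. In this case, if $W$ is the $*$-TRO $\theta(Z)$, then $\theta$ restricts to a $*$-isomorphism of $J(Z)$ onto $J(W)$, and $\theta$ is the restriction of a $*$-isomorphism between $Z+Z^2$ and $W+W^2$.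
   Context: For subsets $X,Y$ of a C*-algebra, $XY$ is the norm closure of the span of the products $xy$, while $X+Y=\{x+y\}$ (no closure). A $*$-TRO is a norm closed selfadjoint subspace $Z$ of a C*-algebra $C$ with $ZZ^*Z\subset Z$. It has the ternary product $[x,y,z]=xy^*z$ and relative cones $M_n(Z)_+=M_n(Z)\cap M_n(C)_+$. Here $Z^2$ and $Z+Z^2$ are C*-subalgebras of $C$, and for a $*$-TRO $Z$ one writes $J(Z)=Z\cap Z^2$, a C*-algebra (an ideal in $Z^2$ and in $Z+Z^2$). A ternary $*$-morphism is a $*$-linear map preserving the ternary product. A map $T$ is positive if it is $*$-linear and maps positive elements to positive elements; it is completely positive if all its matrix amplifications are positive. A map is an order embedding (complete order embedding) if it is injective and it and its inverse, defined on its range, are positive (completely positive). *)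

(* Defs.v *)
From HB Require Import structures.
From mathcomp Require Import all_boot all_order all_algebra.
From mathcomp Require Import complex.
From mathcomp Require Import all_classical all_reals all_analysis.

Set Implicit Arguments.
Unset Strict Implicit.
Unset Printing Implicit Defensive.

Import Order.TTheory GRing.Theory Num.Theory.
Import numFieldNormedType.Exports.

Local Open Scope classical_set_scope.
Local Open Scope ring_scope.

(* C*-algebras are not assumed to be unital, so that the product [amul] cannot
   come from the MathComp ring hierarchy.  The norm takes its values in R[i],
   as for every normed module over R[i]. *)
HB.mixin Record NormedModule_isCStarAlgebra (R : realType) (A : Type)
    of CompleteNormedModule R[i] A := {
  amul : A -> A -> A;
  star : A -> A;
  amulA : associative amul;
  amul_linearl : forall (a : R[i]) (x y z : A),
    amul (a *: x + y) z = a *: amul x z + amul y z;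
  amul_linearr : forall (a : R[i]) (x y z : A),
    amul x (a *: y + z) = a *: amul x y + amul x z;
  starK : involutive star;
  star_antilinear : forall (a : R[i]) (x y : A),
    star (a *: x + y) = a^* *: star x + star y;
  star_amul : forall x y : A, star (amul x y) = amul (star y) (star x);
  norm_amul_le : forall x y : A, `|amul x y| <= `|x| * `|y|;
  cstar_identity : forall x : A, `|amul (star x) x| = `|x| ^+ 2
}.

#[short(type="cstarAlgType")]
HB.structure Definition CStarAlgebra (R : realType) :=
  { A of NormedModule_isCStarAlgebra R A & CompleteNormedModule R[i] A }.

Reserved Notation "x ** y" (at level 40, left associativity).
Notation "x ** y" := (amul x y) : ring_scope.

Section Subsets.
Context {R : realType} {C : cstarAlgType R}.
Implicit Types X Y Z : set C.

(* The closed linear span of X. *)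
Definition cspan_closure X : set C :=
  closure (smallest (fun V : set C => submod_closed (mem V)) X).

Definition prodset X Y : set C :=
  cspan_closure [set x ** y | x in X & y in Y].

Definition addset X Y : set C := [set x + y | x in X & y in Y].

Definition sqset Z : set C := prodset Z Z.

Definition is_starTRO Z : Prop :=
  [/\ submod_closed (mem Z), closed Z, star @` Z `<=` Z &
      prodset (prodset Z (star @` Z)) Z `<=` Z].

Definition JTRO Z : set C := Z `&` sqset Z.

End Subsets.

Section MatrixCone.
Context {R : realType} {C : cstarAlgType R}.

Definition matmul n (X Y : 'M[C]_n) : 'M[C]_n :=
  \matrix_(i, j) \sum_(k < n) X i k ** Y k j.

Definition matstar n (X : 'M[C]_n) : 'M[C]_n :=
  \matrix_(i, j) star (X j i).

(* The positive elements of a C*-algebra are the y^* y.  In M_n(C) this refers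
   to the *-algebra structure only, so that the C*-norm of M_n(C) is not
   needed. *)
Definition pos (x : C) : Prop := exists y : C, x = star y ** y.

Definition matpos n (X : 'M[C]_n) : Prop :=
  exists Y : 'M[C]_n, X = matmul (matstar Y) Y.

End MatrixCone.

(* A map defined on a subset S of C is represented by a function on the whole
   of C, whose values outside of S are irrelevant. *)
Section Maps.
Context {R : realType} {C B : cstarAlgType R}.
Implicit Types (S : set C) (f : C -> B).

Definition star_linear S f : Prop :=
  (forall (a : R[i]) (x y : C), S x -> S y ->
     f (a *: x + y) = a *: f x + f y) /\
  (forall x, S x -> f (star x) = star (f x)).

Definition star_hom S f : Prop :=
  star_linear S f /\ (forall x y, S x -> S y -> f (x ** y) = f x ** f y).

Definition star_iso S (T : set B) f : Prop := star_hom S f /\ set_bij S T f.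

Definition ternary_star_morphism S f : Prop :=
  star_linear S f /\
  (forall x y z, S x -> S y -> S z ->
     f (x ** star y ** z) = f x ** star (f y) ** f z).

Definition positive_map S f : Prop :=
  star_linear S f /\ (forall x, S x -> pos x -> pos (f x)).

(* The amplifications [map_mx f] of a *-linear map are *-linear. *)
Definition completely_positive_map S f : Prop :=
  star_linear S f /\
  (forall n (X : 'M[C]_n), (forall i j, S (X i j)) ->
     matpos X -> matpos (map_mx f X)).

End Maps.

Definition order_embedding (R : realType) (C B : cstarAlgType R) (S : set C)
    (f : C -> B) : Prop :=
  [/\ set_inj S f, positive_map S f &
      exists2 g : B -> C, forall x, S x -> g (f x) = x &
        positive_map (f @` S) g].

Definition complete_order_embedding (R : realType) (C B : cstarAlgType R)
    (S : set C) (f : C -> B) : Prop :=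
  [/\ set_inj S f, completely_positive_map S f &
      exists2 g : B -> C, forall x, S x -> g (f x) = x &
        completely_positive_map (f @` S) g].

(* [(U, e, iota)] is a unitization of the C*-subalgebra A: U is a C*-algebra
   with identity e which is the internal direct sum of a *-isomorphic copy of A
   and of the scalars, i.e., a copy of the usual A (+) C.  An identity is
   adjoined even if A already has one. *)
Definition is_unitization (R : realType) (C : cstarAlgType R) (A : set C)
    (U : cstarAlgType R) (e : U) (iota : C -> U) : Prop :=
  [/\ forall u : U, e ** u = u /\ u ** e = u,
      star_hom A iota, set_inj A iota,
      forall u : U, exists2 a : C, A a & exists l : R[i], u = iota a + l *: e
    & ~ (iota @` A) e].

(* Main.v *)
Require Import Defs.
From HB Require Import structures.
From mathcomp Require Import all_boot all_order all_algebra.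
From mathcomp Require Import complex ring lra.
From mathcomp Require Import all_classical all_reals all_analysis.

Set Implicit Arguments.
Unset Strict Implicit.
Unset Printing Implicit Defensive.

Import Order.TTheory GRing.Theory Num.Theory.
Import numFieldNormedType.Exports.

Local Open Scope classical_set_scope.
Local Open Scope ring_scope.
Local Open Scope complex_scope.

(* A ternary *-morphism on a *-TRO is bounded: a selfadjoint x of norm at most 1
   can be written as 2y / (1 + y^2) with y in Z, and the relation
   2y = x + y x y, which is preserved by the morphism, makes
   (1 - theta(x) theta(y)) + i theta(x) unitary.  Powers of a^* a then give
   |sum theta(x_i) theta(y_i)| <= |sum x_i y_i|, so that pi exists.  If x is a
   selfadjoint element of J(Z), then theta(x^2) and pi(x^2) are commuting positive
   elements with the same square, hence equal, and (theta(x) - pi(x))^2 = 0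
   follows.  Thus z + b |-> theta(z) + pi(b) is a well defined *-homomorphism on
   A = Z + Z^2.  A matrix over Z that is positive in M_n(C) is the square of a
   selfadjoint matrix over A, which gives complete positivity.  The same relation,
   read backwards, shows that the image of a ternary *-morphism is closed; hence
   A and theta(Z) are closed, and everything applies to the inverse of an order
   embedding.  The order theory this rests on, including Kaplansky's theorem that
   every y^* y has a positive square root, comes from the power series of
   1 - sqrt(1 - t), in the form of the iteration d |-> (t + d^2) / 2. *)

(** * The real-valued norm *)

Section RealNorm.
Context {R : realType}.

(** No spectrum and no functional calculus appear. Norm bounds come from commuting self-adjoint
    elements s, a with s^2 + a^2 = 1, positivity is the inequality |t - x| <= t for some t > 0, and
    square roots are limits of explicit iterations. A *-TRO adds an obstacle: [Z] is closed under
    odd products only, so that neither 1 - x^2 nor a root of x need lie in it. This dictates the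
    relation 2y = x + y x y, all of whose terms are odd: it can be solved inside [Z], and every
    ternary morphism respects it. Positivity of theta decides a question of sign: on a C*-algebra,
    -id is a ternary *-morphism whose pi is id, so a ternary morphism and its pi may differ on J(Z).
    That squares go to positive elements excludes this. *)

Lemma gt0_real_complex (e : R[i]) : 0 < e -> exists2 r : R, 0 < r & e = r%:C.
Proof. by case: e => a b; rewrite ltcE /= => /andP[/eqP -> a0]; exists a. Qed.

(** The norm is [R[i]]-valued. Being nonnegative it equals its real part, and with values in [R]
    suprema and [lra] become available. *)
Definition nm {V : normedZmodType R[i]} (x : V) : R := complex.Re `|x|.

Section Zmod.
Context {V : normedZmodType R[i]}.
Implicit Types x y : V.

Lemma nmE x : `|x| = (nm x)%:C.
Proof.
have := normr_ge0 x; rewrite lecE => /andP[/eqP/= h _].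
by rewrite /nm; case: `|x| h => a b /= ->.
Qed.

Lemma nm_ge0 x : 0 <= nm x.
Proof. by rewrite -ler0c -nmE. Qed.

Lemma nm0 : nm (0 : V) = 0.
Proof. by rewrite /nm normr0. Qed.

Lemma nm_eq0 x : nm x = 0 -> x = 0.
Proof. by move=> h; apply/eqP; rewrite -normr_eq0 nmE h. Qed.

Lemma nm_gt0 x : x != 0 -> 0 < nm x.
Proof. by move=> x0; rewrite lt_def nm_ge0 andbT; apply: contra_neq x0 => /nm_eq0. Qed.

Lemma nmD x y : nm (x + y) <= nm x + nm y.
Proof. by rewrite -lecR rmorphD /= -!nmE ler_normD. Qed.

Lemma nmN x : nm (- x) = nm x.
Proof. by rewrite /nm normrN. Qed.

Lemma nmC x y : nm (x - y) = nm (y - x).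
Proof. by rewrite -nmN opprB. Qed.

Lemma nmB x y : nm (x - y) <= nm x + nm y.
Proof. by rewrite -(nmN y) nmD. Qed.

Lemma nm_tri z x y : nm (x - y) <= nm (x - z) + nm (z - y).
Proof. by rewrite -[x - y](subrKA z) nmD. Qed.

Lemma nm_le_dist x y : nm x <= nm y + nm (x - y).
Proof. by rewrite -{1}(subrKC y x) nmD. Qed.

Lemma nm_sum (I : Type) (s : seq I) (P : pred I) (F : I -> V) :
  nm (\sum_(i <- s | P i) F i) <= \sum_(i <- s | P i) nm (F i).
Proof.
elim/big_rec2: _ => [|i r v _ h]; first by rewrite nm0.
by apply: le_trans (nmD _ _) _; rewrite lerD2l.
Qed.

Lemma nm_small0 x : (forall e : R, 0 < e -> nm x < e) -> x = 0.
Proof.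
move=> h; apply: nm_eq0; apply/eqP; rewrite eq_le nm_ge0 andbT leNgt.
by apply/negP => /h; rewrite ltxx.
Qed.

Definition lims (u : nat -> V) (l : V) :=
  forall e : R, 0 < e -> exists N, forall n, (N <= n)%N -> nm (u n - l) < e.

Definition cauchys (u : nat -> V) :=
  forall e : R, 0 < e ->
    exists N, forall m n, (N <= m)%N -> (N <= n)%N -> nm (u m - u n) < e.

(** The scalar sequence [d] is a majorant: it is nondecreasing because its increments dominate
    norms, and its distance to [sup (range d)] controls the tails of [u]. Geometric estimates fit in
    with [d n] of the form - c r^n and [M = 0]. *)
Lemma cauchys_dominated (u : nat -> V) (d : nat -> R) (M : R) :
  (forall n, nm (u n.+1 - u n) <= d n.+1 - d n) -> (forall n, d n <= M) ->
  cauchys u.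
Proof.
move=> hu hM e e0.
have dmono m n : (m <= n)%N -> nm (u n - u m) <= d n - d m.
  move=> /subnK <-; elim: (n - m)%N => [|k IH]; first by rewrite !subrr nm0.
  rewrite addSn; apply: le_trans (nm_tri (u (k + m)%N) _ _) _.
  by have := hu (k + m)%N; lra.
have sd : has_sup (range d).
  by split; [exists (d 0%N), 0%N|exists M => _ [n _ <-]].
have [_ [N _ <-] hN] := sup_adherent e0 sd.
have dle n : d n <= sup (range d) by apply: sup_upper_bound => //; exists n.
exists N => m n Nm Nn.
case/orP: (leq_total m n) => mn.
  rewrite nmC; apply: le_lt_trans (dmono _ _ mn) _.
  have := dle n; have := dmono _ _ Nm; have := nm_ge0 (u m - u N); lra.
apply: le_lt_trans (dmono _ _ mn) _.
have := dle m; have := dmono _ _ Nn; have := nm_ge0 (u n - u N); lra.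
Qed.

Lemma lims_cst x : lims (fun=> x) x.
Proof. by move=> e e0; exists 0%N => n _; rewrite subrr nm0. Qed.

Lemma lims_ext u v x : (forall n, u n = v n) -> lims u x -> lims v x.
Proof. by move=> /funext ->. Qed.

Lemma lims_cauchys u x : lims u x -> cauchys u.
Proof.
move=> hu e e0; have e2 : 0 < e / 2 by lra.
have [N hN] := hu _ e2; exists N => m n /hN hm /hN hn.
have := nm_tri x (u m) (u n); rewrite (nmC x (u n)); lra.
Qed.

Lemma lims_unique u x y : lims u x -> lims u y -> x = y.
Proof.
move=> hx hy; apply/subr0_eq/nm_small0 => e e0.
have e2 : 0 < e / 2 by lra.
have [N1 h1] := hx _ e2; have [N2 h2] := hy _ e2.
have := h1 _ (leq_maxl N1 N2); have := h2 _ (leq_maxr N1 N2).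
have := nm_tri (u (maxn N1 N2)) x y; rewrite (nmC x (u _)); lra.
Qed.

Lemma limsD u v x y : lims u x -> lims v y -> lims (fun n => u n + v n) (x + y).
Proof.
move=> hx hy e e0; have e2 : 0 < e / 2 by lra.
have [N1 h1] := hx _ e2; have [N2 h2] := hy _ e2.
exists (maxn N1 N2) => n; rewrite geq_max => /andP[/h1 {}h1 /h2 {}h2].
rewrite opprD addrACA; apply: le_lt_trans (nmD _ _) _; lra.
Qed.

Lemma lims_nm_le u x (c : R) : lims u x -> (forall n, nm (u n) <= c) -> nm x <= c.
Proof.
move=> hx hc; rewrite leNgt; apply/negP => lt.
have e0 : 0 < nm x - c by lra.
have [N /(_ N (leqnn _))] := hx _ e0; rewrite nmC.
have := hc N; have := nm_le_dist x (u N); lra.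
Qed.

Lemma lims_shift u x : lims u x -> lims (fun n => u n.+1) x.
Proof. by move=> h e /h [N hN]; exists N => n Nn; apply: hN; exact: leqW. Qed.

End Zmod.

Lemma lims_lip {V W : normedZmodType R[i]} (f : V -> W) (K : R) u x :
  (forall n, nm (f (u n) - f x) <= K * nm (u n - x)) ->
  lims u x -> lims (f \o u) (f x).
Proof.
move=> hf h e e0.
have K0 : 0 < `|K| + 1 by have := normr_ge0 K; lra.
have [N hN] := h _ (divr_gt0 e0 K0).
exists N => n /hN; rewrite ltr_pdivlMr//= => lt.
apply: le_lt_trans (hf n) _; apply: le_lt_trans lt.
by rewrite mulrC ler_wpM2l ?nm_ge0//; have := ler_norm K; lra.
Qed.

Section Normed.
Context {V : normedModType R[i]}.
Implicit Types (x y : V) (S : set V).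

Lemma nmZ (a : R[i]) x : nm (a *: x) = nm a * nm x.
Proof.
by apply: complexI; rewrite rmorphM /= -!nmE normrZ.
Qed.

Lemma nm_real (r : R) : nm (r%:C) = `|r|.
Proof. by apply: complexI; rewrite -nmE normc_def /= expr0n /= addr0 sqrtr_sqr. Qed.

Lemma nmZr (r : R) x : nm (r%:C *: x) = `|r| * nm x.
Proof. by rewrite nmZ nm_real. Qed.

Lemma nmM_scalar (a b : R[i]) : nm (a * b) = nm a * nm b.
Proof. by apply: complexI; rewrite rmorphM /= -!nmE normrM. Qed.

Lemma nmV (a : R[i]) : nm a^-1 = (nm a)^-1.
Proof. by apply: complexI; rewrite fmorphV /= -!nmE normfV. Qed.

Lemma nm_i : nm ('i : R[i]) = 1.
Proof. by rewrite /nm normc_def /= expr0n /= expr1n add0r sqrtr1. Qed.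

Lemma nmZi x : nm ('i *: x) = nm x.
Proof. by rewrite nmZ nm_i mul1r. Qed.

Lemma closureP S x :
  closure S x <-> forall e : R, 0 < e -> exists2 y, S y & nm (x - y) < e.
Proof.
split=> [h e e0|h B].
  have /h[y [Sy]] : nbhs x (ball x (e%:C)).
    by apply: nbhsx_ballx; rewrite ltcR.
  by rewrite -ball_normE /= nmE ltcR => ?; exists y.
move=> /nbhs_ballP[e /= e0 hB].
have [r r0 re] := gt0_real_complex e0.
have [y Sy xy] := h _ r0; exists y; split => //; apply: hB.
by rewrite -ball_normE /= nmE re ltcR.
Qed.

Lemma closedP S :
  closed S <-> forall x, (forall e : R, 0 < e -> exists2 y, S y & nm (x - y) < e) -> S x.
Proof.
split=> [h x hx|h]; first by rewrite ((closure_id S).1 h); apply/closureP.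
by rewrite closure_id eqEsubset; split; [exact: subset_closure|
  move=> x /closureP /h].
Qed.

Lemma closed_lims S u x : closed S -> (forall n, S (u n)) -> lims u x -> S x.
Proof.
move=> /closedP cS hu hx; apply: cS => e /hx[N hN].
by exists (u N) => //; rewrite nmC hN.
Qed.

Lemma closure_lims S x : closure S x -> exists2 u, (forall n, S (u n)) & lims u x.
Proof.
move=> /closureP h.
have h' (n : nat) : exists y, S y /\ nm (x - y) < n.+1%:R^-1.
  by have [|y Sy xy] := h (n.+1%:R^-1); [rewrite invr_gt0 ltr0n|exists y].
have [u hu] := choice h'; exists u => [n|e e0]; first by case: (hu n).
exists (Num.truncn (e^-1)).+1 => n Nn; rewrite nmC.
apply: lt_trans (hu n).2 _.
rewrite invf_plt ?posrE ?ltr0n//.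
apply: lt_le_trans (truncnS_gt _) _.
by rewrite ler_nat; exact: leqW.
Qed.

End Normed.

Lemma complete_lims {V : completeNormedModType R[i]} (u : nat -> V) :
  cauchys u -> exists l, lims u l.
Proof.
move=> hu.
have /cauchy_cvg/cvg_ex[l hl] : cauchy (u @ \oo).
  apply/cauchy_ballP => e e0.
  have [r r0 re] := gt0_real_complex e0.
  have [N hN] := hu _ r0.
  exists (u @` [set n | (N <= n)%N], u @` [set n | (N <= n)%N]) => /=.
    by split; exists N => // n Nn; exists n.
  move=> [_ _] [[m Nm <-] [n Nn <-]] /=.
  by rewrite -ball_normE /= nmE re ltcR hN.
exists l => e e0.
have /hl[N _ hN] : nbhs l (ball l e%:C) by apply: nbhsx_ballx; rewrite ltcR.
exists N => n /hN; by rewrite /= -ball_normE /= nmE ltcR nmC.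
Qed.

(** Sequences suffice because the sets of [F] can be taken with diameters below 1/(n+1): points of
    their finite intersections form a Cauchy sequence, and [F] converges to its limit. *)
Lemma lims_complete {V : normedModType R[i]} :
  (forall u : nat -> V, cauchys u -> exists l, lims u l) ->
  forall F : set_system V, ProperFilter F -> cauchy F -> cvg F.
Proof.
move=> hV F FF /cauchy_ballP cF.
have small (n : nat) : exists A : set V, F A /\
    forall x y, A x -> A y -> nm (x - y) < n.+1%:R^-1.
  have e0 : 0 < (n.+1%:R^-1 : R)%:C by rewrite ltcR invr_gt0 ltr0n.
  have [[A1 A2] /= [FA1 FA2] hA] := cF _ e0.
  have e00 := cF _ e0.
  (* A centre [z] whose ball of half the radius belongs to [F] turns the Cauchy condition into a
     bound on a diameter. *)
  have /filter_ex[z hz] : F [set x | F [set y | ball x ((n.+1%:R *2)^-1 : R)%:C y]].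
    have e1 : 0 < ((n.+1%:R * 2)^-1 : R)%:C.
      by rewrite ltcR invr_gt0 mulr_gt0 ?ltr0n.
    have [[B1 B2] /= [FB1 FB2] hB] := cF _ e1.
    apply: filterS FB1 => x B1x; apply: filterS FB2 => y B2y.
    exact: (hB (x, y)).
  exists [set y | ball z ((n.+1%:R *2)^-1 : R)%:C y]; split => // x y.
  rewrite /= -!ball_normE /= !nmE !ltcR => h1 h2.
  have := nm_tri z x y; rewrite (nmC x z).
  move: h1 h2; rewrite invfM; set t := n.+1%:R^-1; lra.
have [A hA] := choice small.
have FI n : F [set x | forall k, (k <= n)%N -> A k x].
  elim: n => [|n IH]; first by apply: filterS (hA 0%N).1 => x Ax [|].
  apply: filterS2 IH (hA n.+1).1 => x h Ax k.
  by rewrite leq_eqVlt => /predU1P[->//|]; exact: h.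
have ex n : exists x, forall k, (k <= n)%N -> A k x.
  by have [x hx] := filter_ex (FI n); exists x.
have [u hu] := choice ex.
have inv_small (e : R) : 0 < e -> exists N : nat, N.+1%:R^-1 < e.
  move=> e0; exists (Num.truncn e^-1); rewrite invf_plt ?posrE ?ltr0n//.
  exact: truncnS_gt.
have [|l hl] := hV u.
  move=> e /inv_small[N hN]; exists N => m n Nm Nn.
  by apply: lt_trans hN; apply: (hA N).2; exact: hu.
apply/cvg_ex; exists l => B /nbhs_ballP[e /= e0 hB].
have [r r0 re] := gt0_real_complex e0.
have r2 : 0 < r / 2 by lra.
have [N hN] := inv_small _ r2; have [M hM] := hl _ r2.
apply: filterS (hA N).1 => y Ay; apply: hB.
rewrite -ball_normE /= nmE re ltcR.
have := hM _ (leq_maxr N M).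
have := lt_trans ((hA N).2 _ _ (hu _ _ (leq_maxl N M)) Ay) hN.
have := nm_tri (u (maxn N M)) l y; rewrite (nmC l (u _)); lra.
Qed.

End RealNorm.

(** Unitizations, matrix algebras and closed subalgebras all receive their C*-structure through this
    interface: a real norm and sequential completeness, from which the topology and the
    complex-valued norm are derived. *)
HB.factory Record Lmodule_isCStarAlgebra (R : realType) A of GRing.Lmodule R[i] A := {
  rnorm : A -> R;
  rnormD : forall x y, rnorm (x + y) <= rnorm x + rnorm y;
  rnormZ : forall (a : R[i]) x, rnorm (a *: x) = nm a * rnorm x;
  rnorm_eq0 : forall x, rnorm x = 0 -> x = 0;
  rnorm_complete : forall u : nat -> A,
    (forall e : R, 0 < e -> exists N, forall m n, (N <= m)%N -> (N <= n)%N ->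
       rnorm (u m - u n) < e) ->
    exists l, forall e : R, 0 < e -> exists N, forall n, (N <= n)%N ->
       rnorm (u n - l) < e;
  mul : A -> A -> A;
  adj : A -> A;
  mul_assoc : associative mul;
  mul_linearl : forall (a : R[i]) (x y z : A),
    mul (a *: x + y) z = a *: mul x z + mul y z;
  mul_linearr : forall (a : R[i]) (x y z : A),
    mul x (a *: y + z) = a *: mul x y + mul x z;
  adjK : involutive adj;
  adj_antilinear : forall (a : R[i]) (x y : A),
    adj (a *: x + y) = (a^*)%R *: adj x + adj y;
  adj_mul : forall x y : A, adj (mul x y) = mul (adj y) (adj x);
  rnorm_mul : forall x y : A, rnorm (mul x y) <= rnorm x * rnorm y;
  rnorm_cstar : forall x : A, rnorm (mul (adj x) x) = rnorm x ^+ 2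
}.

HB.builders Context R A of Lmodule_isCStarAlgebra R A.

Let cnorm (x : A) : R[i] := (rnorm x)%:C.

Let cnormD x y : cnorm (x + y) <= cnorm x + cnorm y.
Proof. by rewrite /cnorm -rmorphD lecR rnormD. Qed.

Let cnormZ (l : R[i]) x : cnorm (l *: x) = `|l| * cnorm x.
Proof. by rewrite /cnorm rnormZ rmorphM nmE. Qed.

Let cnorm_eq0 x : cnorm x = 0 -> x = 0.
Proof. by move=> [/rnorm_eq0]. Qed.

HB.instance Definition _ := Lmodule_isNormed.Build R[i] A cnormD cnormZ cnorm_eq0.

Let cauchy_cvg (F : set_system A) : ProperFilter F -> cauchy F -> cvg F.
Proof. by apply: lims_complete => u /rnorm_complete. Qed.

HB.instance Definition _ := Uniform_isComplete.Build A cauchy_cvg.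

Let norm_mul (x y : A) : `|mul x y| <= `|x| * `|y|.
Proof. by rewrite /Num.norm /= /cnorm -rmorphM lecR rnorm_mul. Qed.

Let norm_cstar (x : A) : `|mul (adj x) x| = `|x| ^+ 2.
Proof. by rewrite /Num.norm /= /cnorm rnorm_cstar rmorphXn. Qed.

HB.instance Definition _ := NormedModule_isCStarAlgebra.Build R A
  mul_assoc mul_linearl mul_linearr adjK adj_antilinear adj_mul norm_mul norm_cstar.

HB.end.

(** * C*-algebras *)

Section CStarBasics.
Context {R : realType} {A : cstarAlgType R}.
Implicit Types (x y z : A) (a : R[i]).

Lemma amulDl x y z : (x + y) ** z = x ** z + y ** z.
Proof. by have := amul_linearl 1 x y z; rewrite !scale1r. Qed.

Lemma amulDr x y z : x ** (y + z) = x ** y + x ** z.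
Proof. by have := amul_linearr 1 x y z; rewrite !scale1r. Qed.

Lemma amul0x x : 0 ** x = 0.
Proof. by apply: (addIr (0 ** x)); rewrite -amulDl !add0r. Qed.

Lemma amulx0 x : x ** 0 = 0.
Proof. by apply: (addIr (x ** 0)); rewrite -amulDr !add0r. Qed.

Lemma amulZl a x y : (a *: x) ** y = a *: (x ** y).
Proof. by have := amul_linearl a x 0 y; rewrite amul0x !addr0. Qed.

Lemma amulZr a x y : x ** (a *: y) = a *: (x ** y).
Proof. by have := amul_linearr a x y 0; rewrite amulx0 !addr0. Qed.

Lemma amulNl x y : (- x) ** y = - (x ** y).
Proof. by rewrite -scaleN1r amulZl scaleN1r. Qed.

Lemma amulNr x y : x ** (- y) = - (x ** y).
Proof. by rewrite -scaleN1r amulZr scaleN1r. Qed.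

Lemma amulBl x y z : (x - y) ** z = x ** z - y ** z.
Proof. by rewrite amulDl amulNl. Qed.

Lemma amulBr x y z : x ** (y - z) = x ** y - x ** z.
Proof. by rewrite amulDr amulNr. Qed.

Lemma amul_suml (I : Type) (s : seq I) (P : pred I) (F : I -> A) y :
  (\sum_(i <- s | P i) F i) ** y = \sum_(i <- s | P i) F i ** y.
Proof. by apply: (big_morph (fun u : A => u ** y)) => [u v|]; rewrite ?amulDl ?amul0x. Qed.

Lemma amul_sumr (I : Type) (s : seq I) (P : pred I) (F : I -> A) y :
  y ** (\sum_(i <- s | P i) F i) = \sum_(i <- s | P i) y ** F i.
Proof. by apply: (big_morph (amul y)) => [u v|]; rewrite ?amulDr ?amulx0. Qed.

Lemma starD x y : star (x + y) = star x + star y.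
Proof. by have := star_antilinear 1 x y; rewrite !scale1r rmorph1 scale1r. Qed.

Lemma star0 : star 0 = 0 :> A.
Proof. by apply: (addIr (star 0)); rewrite -starD !add0r. Qed.

Lemma starZ a x : star (a *: x) = (a^*)%R *: star x.
Proof. by have := star_antilinear a x 0; rewrite star0 !addr0. Qed.

Lemma starZr (r : R) x : star (r%:C *: x) = r%:C *: star x.
Proof. by rewrite starZ; congr (_ *: _); exact: conjc_real. Qed.

Lemma starZi x : star ('i *: x) = - ('i *: star x).
Proof.
rewrite starZ -scaleNr; congr (_ *: _).
by apply/eqP; rewrite eq_complex /= oppr0 !eqxx.
Qed.

Lemma starN x : star (- x) = - star x.
Proof. by rewrite -scaleN1r starZ rmorphN1 scaleN1r. Qed.

Lemma starB x y : star (x - y) = star x - star y.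
Proof. by rewrite starD starN. Qed.

Lemma star_sum (I : Type) (s : seq I) (P : pred I) (F : I -> A) :
  star (\sum_(i <- s | P i) F i) = \sum_(i <- s | P i) star (F i).
Proof. by apply: (big_morph star) => [u v|]; rewrite ?starD ?star0. Qed.

Lemma nm_amul x y : nm (x ** y) <= nm x * nm y.
Proof. by rewrite -lecR rmorphM /= -!nmE norm_amul_le. Qed.

Lemma nm_cstar x : nm (star x ** x) = nm x ^+ 2.
Proof. by apply: complexI; rewrite rmorphXn /= -!nmE cstar_identity. Qed.

Lemma nm_star x : nm (star x) = nm x.
Proof.
have h y : nm y <= nm (star y).
  have [->|y0] := eqVneq y 0; first by rewrite nm0 nm_ge0.
  have yp := nm_gt0 y0.
  by rewrite -(ler_pM2r yp) -expr2 -nm_cstar nm_amul.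
by apply/eqP; rewrite eq_le h andbT -{2}[x]starK h.
Qed.

Lemma nm_sqr_sa x : star x = x -> nm (x ** x) = nm x ^+ 2.
Proof. by move=> xs; rewrite -nm_cstar xs. Qed.

Lemma amul_sa0 x : star x = x -> x ** x = 0 -> x = 0.
Proof.
move=> xs h; apply: nm_eq0; apply/eqP.
by rewrite -sqrf_eq0 -nm_sqr_sa// h nm0.
Qed.

Lemma cstar0 x : star x ** x = 0 -> x = 0.
Proof.
move=> h; apply: nm_eq0; apply/eqP.
by rewrite -sqrf_eq0 -nm_cstar h nm0.
Qed.

(** The explicit formulas for [u] and [v] are exported so that membership in a self-adjoint subspace
    and norm bounds can be read off. *)
Lemma sa_decomp x : exists u v : A,
  [/\ star u = u, star v = v, x = u + 'i *: v, u = (2^-1)%:C *: (x + star x)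
    & v = ((2^-1)%:C * - 'i) *: (x - star x)].
Proof.
exists ((2^-1)%:C *: (x + star x)), (((2^-1)%:C * - 'i) *: (x - star x)); split => //.
- by rewrite starZr starD starK addrC.
- rewrite -scalerA starZr scaleNr starN starZi opprK starB starK.
  by rewrite -(opprB x) scalerN.
- rewrite scalerA [X in _ + X *: _](_ : _ = (2^-1)%:C); last first.
    apply/eqP; rewrite eq_complex /=; apply/andP; split; apply/eqP; ring.
  by rewrite -scalerDr addrACA subrr addr0 -mulr2n -[x *+ 2]scaler_nat scalerA -(rmorph_nat (real_complex R)) -rmorphM /= mulVf ?pnatr_eq0// scale1r.
Qed.

Lemma lims_amul_l (u : nat -> A) x z : lims u x -> lims (fun n => u n ** z) (x ** z).
Proof.
apply: (@lims_lip _ _ _ (fun w => w ** z) (nm z)) => n.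
by rewrite -amulBl mulrC nm_amul.
Qed.

Lemma lims_amul_r (u : nat -> A) x z : lims u x -> lims (fun n => z ** u n) (z ** x).
Proof.
by apply: (@lims_lip _ _ _ (amul z) (nm z)) => n; rewrite -amulBr nm_amul.
Qed.

Lemma lims_star (u : nat -> A) x : lims u x -> lims (fun n => star (u n)) (star x).
Proof.
by apply: (@lims_lip _ _ _ star 1) => n; rewrite -starB nm_star mul1r.
Qed.

Lemma limsZ {V : normedModType R[i]} (u : nat -> V) a (x : V) :
  lims u x -> lims (fun n => a *: u n) (a *: x).
Proof.
by apply: (@lims_lip _ _ _ ( *:%R a) (nm a)) => n; rewrite -scalerBr nmZ.
Qed.

Lemma lims_eq_closed (f g : A -> A) :
  (forall u x, lims u x -> lims (f \o u) (f x)) ->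
  (forall u x, lims u x -> lims (g \o u) (g x)) ->
  closed [set x | f x = g x].
Proof.
move=> hf hg; apply/closedP => x h.
have /closure_lims[u ufg ux] : closure [set x | f x = g x] x by apply/closureP.
apply: (lims_unique (hf _ _ ux)).
by have := hg _ _ ux; congr lims; apply/funext => n /=; rewrite ufg.
Qed.

Lemma closed_sa : closed [set x : A | star x = x].
Proof. by apply: lims_eq_closed => u x // /lims_star. Qed.

Lemma closed_comm z : closed [set x : A | x ** z = z ** x].
Proof. by apply: lims_eq_closed => u x h; [exact: lims_amul_l|exact: lims_amul_r]. Qed.

End CStarBasics.

(** * The fixed point of y |-> (p + y q y) / 2 *)

Section Iteration.
Context {R : realType} {A : cstarAlgType R}.
Variables (p q : A).
Hypotheses (p1 : nm p <= 1) (q1 : nm q <= 1).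

Let half : R[i] := (2^-1 : R)%:C.

Let d (n : nat) : A := iter n (fun y => half *: (p + y ** q ** y)) 0.

(* The scalar iteration started with p = q = 1, which increases to 1. *)
Let delta (n : nat) : R := iter n (fun t => 2^-1 * (1 + t ^+ 2)) 0.

Let delta_bounds n : 0 <= delta n <= 1.
Proof.
elim: n => [|n]; first by rewrite /= lexx ler01.
by rewrite /delta iterS -/(delta n); move: (delta n) => t; nra.
Qed.

Let nm_d n : nm (d n) <= delta n.
Proof.
elim: n => [|n IH]; first by rewrite nm0.
rewrite /delta /d !iterS -/(d n) -/(delta n) nmZr ger0_norm; last lra.
rewrite ler_wpM2l//.
apply: le_trans (nmD _ _) _; apply: lerD => //.
apply: le_trans (nm_amul _ _) _; rewrite expr2.
apply: ler_pM => //; rewrite ?nm_ge0//.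
apply: le_trans (nm_amul _ _) _; rewrite -[leRHS]mulr1.
by apply: ler_pM; rewrite ?nm_ge0.
Qed.

Let nm_d_step n : nm (d n.+1 - d n) <= delta n.+1 - delta n.
Proof.
elim: n => [|n IH].
  rewrite /d /delta /= amulx0 subr0 addr0 nmZr ger0_norm; last lra.
  by rewrite expr0n /= subr0 addr0 ler_wpM2l.
have -> : d n.+2 - d n.+1 =
  half *: (p + d n.+1 ** q ** d n.+1) - half *: (p + d n ** q ** d n) by [].
have -> : delta n.+2 - delta n.+1 =
  2^-1 * (1 + delta n.+1 ^+ 2) - 2^-1 * (1 + delta n ^+ 2) by [].
rewrite -scalerBr [p + _]addrC addrKA nmZr ger0_norm; last lra.
set y := d n.+1 in IH *; set x := d n in IH *.
have -> : y ** q ** y - x ** q ** x = (y - x) ** q ** y + x ** q ** (y - x).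
  by rewrite amulBl amulBl amulBr addrA subrK.
have hy : nm y <= delta n.+1 by exact: nm_d.
have hx : nm x <= delta n by exact: nm_d.
move: (delta n.+1) (delta n) IH hx hy => s t IH hx hy.
(* The bounds of the two pieces add up to (s - t) s + t (s - t) = s^2 - t^2, twice the increment of
   the scalar iteration. *)
have b1 : nm ((y - x) ** q ** y) <= (s - t) * s.
  apply: le_trans (nm_amul _ _) _; apply: ler_pM => //; rewrite ?nm_ge0//.
  apply: le_trans (nm_amul _ _) _; rewrite -[leRHS]mulr1.
  by apply: ler_pM; rewrite ?nm_ge0.
have b2 : nm (x ** q ** (y - x)) <= t * (s - t).
  apply: le_trans (nm_amul _ _) _; apply: ler_pM => //; rewrite ?nm_ge0//.
  apply: le_trans (nm_amul _ _) _; rewrite -[leRHS]mulr1.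
  by apply: ler_pM; rewrite ?nm_ge0.
have := nmD ((y - x) ** q ** y) (x ** q ** (y - x)); lra.
Qed.

(** The map need not be a strict contraction on the unit ball, so convergence comes from the scalar
    majorant. The last clause is an induction principle: closed properties that hold at 0 and
    survive a step hold for the limit. With [q = 1] the limit is 1 - sqrt(1 - p); with [q = p] it
    solves 2y = p + y p y. *)
Lemma quadratic_fixpoint : exists y : A,
  [/\ nm y <= 1, y + y = p + y ** q ** y &
      forall P : set A, closed P -> P 0 ->
        (forall y, P y -> P (half *: (p + y ** q ** y))) -> P y].
Proof.
have [|y hy] := @complete_lims _ A d.
  apply: cauchys_dominated nm_d_step (_ : forall n, delta n <= 1) => n.
  by case/andP: (delta_bounds n).
exists y; split.
- apply: lims_nm_le hy _ => n; apply: le_trans (nm_d n) _.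
  by case/andP: (delta_bounds n).
- have h1 : lims (fun n => d n.+1) (half *: (p + y ** q ** y)).
    apply: (@lims_lip _ _ _ (fun y => half *: (p + y ** q ** y)) (2^-1 * (1 + nm y))) hy.
    move=> n; rewrite -scalerBr nmZr ger0_norm; last lra.
    rewrite -mulrA ler_wpM2l//.
    rewrite [p + _]addrC addrKA.
    have -> : d n ** q ** d n - y ** q ** y = (d n - y) ** q ** d n + y ** q ** (d n - y).
      by rewrite amulBl amulBl amulBr addrA subrK.
    apply: le_trans (nmD _ _) _; rewrite mulrDl; apply: lerD.
      apply: le_trans (nm_amul _ _) _; rewrite mulrC.
      apply: ler_pM; rewrite ?nm_ge0//.
        by apply: le_trans (nm_d n) _; case/andP: (delta_bounds n).
      apply: le_trans (nm_amul _ _) _; rewrite -[leRHS]mulr1.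
      by apply: ler_pM; rewrite ?nm_ge0.
    apply: le_trans (nm_amul _ _) _; apply: ler_pM; rewrite ?nm_ge0//.
    apply: le_trans (nm_amul _ _) _; rewrite -[leRHS]mulr1.
    by apply: ler_pM; rewrite ?nm_ge0.
  rewrite [in LHS](lims_unique (lims_shift hy) h1) -scalerDl -rmorphD /=.
  by rewrite -[RHS]scale1r; congr (_ *: _); congr (_ +i* _); lra.
- move=> P cP P0 hP; apply: closed_lims cP _ hy => n.
  by elim: n => [//|n IH]; exact: hP.
Qed.

End Iteration.

(** * The unitization *)

Section OperatorNorm.
Context {R : realType} {V W : Type} (NV : V -> R) (NW : W -> R).
Hypotheses (NV0 : forall v, 0 <= NV v) (NW0 : forall w, 0 <= NW w).

(** [NV] and [NW] are bare functions, so that this applies before any normed structure exists. The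
    infimum of the empty set is 0, which is why [opnP] asks for some bound [K]. *)
Definition opn (T : V -> W) : R :=
  inf [set K | 0 <= K /\ forall v, NW (T v) <= K * NV v].

Lemma opn_le (T : V -> W) K :
  0 <= K -> (forall v, NW (T v) <= K * NV v) -> opn T <= K.
Proof. by move=> K0 hK; apply: ge_inf => //; exists 0 => L []. Qed.

Lemma opn_ge0 (T : V -> W) : 0 <= opn T.
Proof.
rewrite /opn; have [->|/set0P ne] := eqVneq [set K | 0 <= K /\ forall v, NW (T v) <= K * NV v] set0.
  by rewrite inf0.
by apply: lb_le_inf => // K [].
Qed.

Lemma opnP (T : V -> W) K v :
  (forall v, NW (T v) <= K * NV v) -> NW (T v) <= opn T * NV v.
Proof.
move=> hK; have := NV0 v; rewrite le_eqVlt => /predU1P[v0|vp].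
  by rewrite -v0 mulr0; have := hK v; rewrite -v0 mulr0.
rewrite -ler_pdivrMr//; apply: lb_le_inf.
  exists `|K|; split => // w; apply: le_trans (hK w) _.
  by rewrite ler_wpM2r// ler_norm.
by move=> L [_ hL]; rewrite ler_pdivrMr.
Qed.

End OperatorNorm.

(** A separate name for the product type, so that it can carry the C*-norm instead of the maximum
    norm of pairs. *)
Definition unitz (R : realType) (A : cstarAlgType R) : Type := (A * R[i]^o)%type.

Section Unitization.
Context {R : realType} {A : cstarAlgType R}.
Local Notation U := (unitz A).
Implicit Types (u v w : U) (a b : A).

HB.instance Definition _ := GRing.Lmodule.copy U (A * R[i]^o)%type.

Definition uone : U := (0, 1).
Definition umul u v : U := (u.1 ** v.1 + u.2 *: v.1 + v.2 *: u.1, u.2 * v.2).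
Definition ustar u : U := (star u.1, (u.2^*)%R).
Definition uact u b : A := u.1 ** b + u.2 *: b.
(** Left multiplication on [A] alone is not faithful if [A] has an identity e: the pair (-e, 1) acts
    as 0. The character [u.2] separates such elements, and the maximum of two C*-seminorms is again
    one. *)
Definition unorm u : R := Num.max (opn (@nm R A) (@nm R A) (uact u)) (nm (u.2 : R[i])).

Let pairP (u v : U) : u.1 = v.1 -> u.2 = v.2 -> u = v.
Proof. by case: u v => [? ?] [? ?] /= -> ->. Qed.

Let umulA : associative umul.
Proof.
move=> u v w; apply: pairP => /=; last exact: mulrA.
rewrite !amulDl !amulDr !amulZl !amulZr !scalerDr !scalerA -!addrA amulA.
congr (_ + _); rewrite [w.2 * u.2]mulrC [w.2 * v.2]mulrC.
rewrite [RHS]addrCA; congr (_ + _).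
rewrite [LHS]addrCA; congr (_ + _).
by rewrite [LHS]addrCA.
Qed.

Let umul1 : left_id uone umul.
Proof.
by move=> u; apply: pairP => /=; rewrite ?mul1r// amul0x scale1r scaler0 add0r addr0.
Qed.

Let umulr1 : right_id uone umul.
Proof.
by move=> u; apply: pairP => /=; rewrite ?mulr1// amulx0 scaler0 scale1r !add0r.
Qed.

Let umulDl : left_distributive umul +%R.
Proof.
move=> u v w; apply: pairP => /=; last exact: mulrDl.
by rewrite amulDl scalerDl scalerDr [RHS]addrACA; congr (_ + _); exact: addrACA.
Qed.

Let umulDr : right_distributive umul +%R.
Proof.
move=> u v w; apply: pairP => /=; last exact: mulrDr.
by rewrite amulDr scalerDl scalerDr [RHS]addrACA; congr (_ + _); exact: addrACA.
Qed.

Let uone_neq0 : uone != 0.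
Proof. by apply/negP => /eqP/(congr1 snd)/eqP /=; rewrite oner_eq0. Qed.

HB.instance Definition _ := GRing.Zmodule_isNzRing.Build U
  umulA umul1 umulr1 umulDl umulDr uone_neq0.

Let uscaleAl (l : R[i]) u v : l *: (u * v) = (l *: u) * v.
Proof.
apply: pairP => /=; last exact: mulrA.
by rewrite amulZl !scalerDr !scalerA [l * v.2]mulrC.
Qed.

HB.instance Definition _ := GRing.Lmodule_isLalgebra.Build R[i] U uscaleAl.

Let uscaleAr (l : R[i]) u v : l *: (u * v) = u * (l *: v).
Proof.
apply: pairP => /=; last exact: mulrCA.
by rewrite amulZr !scalerDr !scalerA [l * u.2]mulrC.
Qed.

HB.instance Definition _ := GRing.Lalgebra_isAlgebra.Build R[i] U uscaleAr.

Lemma uactD u v b : uact (u + v) b = uact u b + uact v b.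
Proof. by rewrite /uact /= amulDl scalerDl addrACA. Qed.

Lemma uactM u v b : uact (u * v) b = uact u (uact v b).
Proof.
rewrite /uact /= !amulDr !amulDl !scalerDr !amulZl !amulZr scalerA amulA -!addrA.
by congr (_ + _); rewrite addrCA.
Qed.

Lemma uactZ (l : R[i]) u b : uact (l *: u) b = l *: uact u b.
Proof. by rewrite /uact /= amulZl scalerDr scalerA. Qed.

Lemma uact_bound u b : nm (uact u b) <= (nm u.1 + nm (u.2 : R[i])) * nm b.
Proof.
apply: le_trans (nmD _ _) _; rewrite mulrDl; apply: lerD; first exact: nm_amul.
by rewrite nmZ.
Qed.

Let op u : R := opn (@nm R A) (@nm R A) (uact u).

Let opP u b : nm (uact u b) <= op u * nm b.
Proof. exact: opnP (@nm_ge0 _ _) _ _ _ (uact_bound u). Qed.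

Let op_le u K : 0 <= K -> (forall b, nm (uact u b) <= K * nm b) -> op u <= K.
Proof. exact: opn_le. Qed.

Let op_ge0 u : 0 <= op u.
Proof. exact: opn_ge0. Qed.

Let unormE u : unorm u = Num.max (op u) (nm (u.2 : R[i])).
Proof. by []. Qed.

Let unorm_le u K : op u <= K -> nm (u.2 : R[i]) <= K -> unorm u <= K.
Proof. by rewrite unormE ge_max => -> ->. Qed.

Let op_unorm u : op u <= unorm u.
Proof. by rewrite unormE le_max lexx. Qed.

Let snd_unorm u : nm (u.2 : R[i]) <= unorm u.
Proof. by rewrite unormE le_max lexx orbT. Qed.

Let unorm_ge0 u : 0 <= unorm u.
Proof. exact: le_trans (op_ge0 u) (op_unorm u). Qed.

(** Letting [u] act on the adjoint of [u.1] recovers |u.1|^2 up to the scalar term. Definiteness and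
    completeness of [unorm] follow from this bound. *)
Let fst_unorm u : nm u.1 <= unorm u + unorm u.
Proof.
have [->|a0] := eqVneq u.1 0; first by rewrite nm0 addr_ge0.
have ap : 0 < nm u.1.
  by rewrite lt_def nm_ge0 andbT; apply: contra_neq a0 => /nm_eq0.
rewrite -(ler_pM2r ap) -expr2 mulrDl.
have -> : nm u.1 ^+ 2 = nm (u.1 ** star u.1).
  by rewrite -(nm_star u.1) -nm_cstar starK.
rewrite [u.1 ** _](_ : _ = uact u (star u.1) - u.2 *: star u.1); last first.
  by rewrite addrK.
apply: le_trans (nmB _ _) _; apply: lerD.
  apply: le_trans (opP _ _) _; rewrite nm_star.
  by apply: ler_wpM2r (op_unorm _); rewrite nm_ge0.
rewrite nmZ nm_star.
by apply: ler_wpM2r (snd_unorm _); rewrite nm_ge0.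
Qed.

Let unorm_fst u : unorm u <= nm u.1 + nm (u.2 : R[i]).
Proof.
apply: unorm_le; last by rewrite lerDr nm_ge0.
by apply: op_le => [|b]; rewrite ?addr_ge0 ?nm_ge0// uact_bound.
Qed.

Let unormD u v : unorm (u + v) <= unorm u + unorm v.
Proof.
apply: unorm_le.
  apply: op_le => [|b]; first by rewrite addr_ge0.
  rewrite uactD mulrDl; apply: le_trans (nmD _ _) _.
  apply: lerD; apply: le_trans (opP _ _) _;
  by apply: ler_wpM2r (op_unorm _); rewrite nm_ge0.
by apply: le_trans (nmD _ _) _; apply: lerD.
Qed.

Let unormZ_le (l : R[i]) u : unorm (l *: u) <= nm l * unorm u.
Proof.
apply: unorm_le.
  apply: op_le => [|b]; first by rewrite mulr_ge0 ?nm_ge0.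
  rewrite uactZ nmZ -mulrA; apply: ler_wpM2l; first exact: nm_ge0.
  by apply: le_trans (opP _ _) _; apply: ler_wpM2r (op_unorm _); rewrite nm_ge0.
rewrite (_ : (l *: u).2 = l * u.2)// nmM_scalar.
by apply: ler_wpM2l; rewrite ?nm_ge0.
Qed.

Let unormZ (l : R[i]) u : unorm (l *: u) = nm l * unorm u.
Proof.
apply/eqP; rewrite eq_le unormZ_le /=.
have [->|l0] := eqVneq l 0; first by rewrite nm0 mul0r.
have lp := nm_gt0 l0.
rewrite -ler_pdivlMl// -[X in unorm X <= _]scale1r -[1](mulVf l0) -scalerA.
by apply: le_trans (unormZ_le _ _) _; rewrite nmV.
Qed.

Let unorm_eq0 u : unorm u = 0 -> u = 0.
Proof.
move=> u0; apply: pairP; apply: nm_eq0; apply/eqP; rewrite eq_le nm_ge0 andbT.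
  by have := fst_unorm u; rewrite u0 addr0.
by have := snd_unorm u; rewrite u0.
Qed.

Let unorm_complete (s : nat -> U) :
  (forall e : R, 0 < e -> exists N, forall m n, (N <= m)%N -> (N <= n)%N ->
       unorm (s m - s n) < e) ->
    exists l, forall e : R, 0 < e -> exists N, forall n, (N <= n)%N ->
       unorm (s n - l) < e.
Proof.
move=> hs.
have [|a ha] := @complete_lims _ A (fun n => (s n).1).
  move=> e e0; have e2 : 0 < e / 2 by lra.
  have [N hN] := hs _ e2; exists N => m n Nm Nn.
  by apply: le_lt_trans (fst_unorm (s m - s n)) _; have := hN _ _ Nm Nn; lra.
have hl : cauchys (fun n => (s n).2 : R[i]^o).
  move=> e e0; have [N hN] := hs _ e0; exists N => m n Nm Nn.
  exact: le_lt_trans (snd_unorm (s m - s n)) (hN _ _ Nm Nn).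
have [l {}hl] : exists l : R[i]^o, lims (fun n => (s n).2 : R[i]^o) l.
  have ReIm (z : R[i]^o) : [/\ `|complex.Re z| <= nm z, `|complex.Im z| <= nm z &
      nm z <= `|complex.Re z| + `|complex.Im z|].
    case: z => x y /=; rewrite /nm normc_def /=; split.
    - by rewrite -sqrtr_sqr ler_wsqrtr// lerDl sqr_ge0.
    - by rewrite -sqrtr_sqr ler_wsqrtr// lerDr sqr_ge0.
    - rewrite -[leRHS]ger0_norm ?addr_ge0// -sqrtr_sqr ler_wsqrtr// sqrrD !real_normK ?num_real//.
      by rewrite -addrA lerD2l lerDr mulrn_wge0// mulr_ge0.
  have cR (f : R[i]^o -> R) : (forall z z' : R[i]^o, f (z - z') = f z - f z') ->
      (forall z, `|f z| <= nm z) ->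
      exists r, forall e : R, 0 < e -> exists N, forall n, (N <= n)%N -> `|f (s n).2 - r| < e.
    move=> fB fle.
    have /R_complete/cvg_ex[r hr] : cauchy ((fun n => f (s n).2) @ \oo).
      apply/cauchy_ballP => e e0; have [N hN] := hl _ e0.
      pose S := [set x | exists2 n, (N <= n)%N & x = f (s n).2].
      exists (S, S) => /=.
        by split; exists N => // n Nn; exists n.
      move=> [_ _] [[m Nm ->] [n Nn ->]] /=.
      rewrite /ball /= -fB; exact: le_lt_trans (fle _) (hN _ _ Nm Nn).
    exists r => e e0; have /hr[N _ hN] : nbhs r (ball r e) by exact: nbhsx_ballx.
    by exists N => n /hN; rewrite /= /ball /= distrC.
  have [||x hx] := cR (@complex.Re R); first by move=> z z'; rewrite raddfB.
    by move=> z; have [] := ReIm z.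
  have [||y hy] := cR (@complex.Im R); first by move=> z z'; rewrite raddfB.
    by move=> z; have [] := ReIm z.
  exists (x +i* y) => e e0; have e2 : 0 < e / 2 by lra.
  have [N hN] := hx _ e2; have [M hM] := hy _ e2.
  exists (maxn N M) => n; rewrite geq_max => /andP[/hN {}hN /hM {}hM].
  have [_ _ h] := ReIm ((s n).2 - (x +i* y)).
  by apply: le_lt_trans h _; rewrite !raddfB /=; lra.
exists (a, l) => e e0; have e2 : 0 < e / 2 by lra.
have [N hN] := ha _ e2; have [M hM] := hl _ e2.
exists (maxn N M) => n; rewrite geq_max => /andP[/hN {}hN /hM {}hM].
apply: le_lt_trans (unorm_fst _) _ => /=; lra.
Qed.

Let ustarK : involutive ustar.
Proof. by move=> u; apply: pairP => /=; rewrite ?starK ?conjCK. Qed.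

Let ustar_antilinear (l : R[i]) u v :
  ustar (l *: u + v) = (l^*)%R *: ustar u + ustar v.
Proof. by apply: pairP => /=; rewrite ?star_antilinear// rmorphD rmorphM. Qed.

Let ustar_mul u v : ustar (u * v) = ustar v * ustar u.
Proof.
apply: pairP => /=; last by rewrite rmorphM mulrC.
by rewrite !starD !starZ star_amul addrAC.
Qed.

Let unorm_mul u v : unorm (u * v) <= unorm u * unorm v.
Proof.
apply: unorm_le.
  apply: op_le => [|b]; first by rewrite mulr_ge0.
  rewrite uactM; apply: le_trans (opP _ _) _; rewrite -mulrA.
  apply: ler_pM; rewrite ?nm_ge0//.
  by apply: le_trans (opP _ _) _; apply: ler_wpM2r (op_unorm _); rewrite nm_ge0.
rewrite (_ : (u * v).2 = u.2 * v.2)// nmM_scalar.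
by apply: ler_pM; rewrite ?nm_ge0.
Qed.

Let uact_adj u b c : star (uact u b) ** c = star b ** uact (ustar u) c.
Proof.
by rewrite /uact /= starD star_amul starZ amulDl amulDr amulZl amulZr amulA.
Qed.

(** [A] is a Hilbert module over itself with inner product b^* c, and by [uact_adj] the action
    respects adjoints, so that |u b|^2 = |b^* (u^* u b)|. *)
Let unorm_sqr_le u : unorm u ^+ 2 <= unorm (ustar u * u).
Proof.
have h : unorm u <= Num.sqrt (unorm (ustar u * u)).
  apply: unorm_le.
    apply: op_le => [|b]; first exact: sqrtr_ge0.
    rewrite -(@ler_pXn2r _ 2) ?nnegrE ?mulr_ge0 ?nm_ge0 ?sqrtr_ge0//.
    rewrite exprMn sqr_sqrtr// -nm_cstar uact_adj -uactM.
    apply: le_trans (nm_amul _ _) _; rewrite nm_star mulrC expr2 mulrA.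
    apply: ler_wpM2r; rewrite ?nm_ge0//.
    by apply: le_trans (opP _ _) _; apply: ler_wpM2r (op_unorm _); rewrite nm_ge0.
  rewrite -(@ler_pXn2r _ 2) ?nnegrE ?nm_ge0 ?sqrtr_ge0// sqr_sqrtr//.
  apply: le_trans (snd_unorm _).
  rewrite (_ : (ustar u * u).2 = (u.2)^*%R * u.2)//.
  suff -> : nm ((u.2)^*%R * u.2) = nm (u.2 : R[i]) ^+ 2 by [].
  by rewrite nmM_scalar expr2; congr (_ * _); rewrite /nm norm_conjC.
rewrite -[leRHS]sqr_sqrtr//; apply: lerXn2r h; rewrite ?nnegrE ?sqrtr_ge0//.
Qed.

Let unorm_cstar u : unorm (ustar u * u) = unorm u ^+ 2.
Proof.
have h v : unorm v <= unorm (ustar v).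
  have [->|v0] := eqVneq (unorm v) 0; first exact: unorm_ge0.
  have vp : 0 < unorm v by rewrite lt_def v0 unorm_ge0.
  rewrite -(ler_pM2r vp) -expr2.
  exact: le_trans (unorm_sqr_le _) (unorm_mul _ _).
apply/eqP; rewrite eq_le unorm_sqr_le andbT.
apply: le_trans (unorm_mul _ _) _; rewrite expr2; apply: ler_wpM2r => //.
by rewrite -{2}[u]ustarK h.
Qed.

HB.instance Definition _ := Lmodule_isCStarAlgebra.Build R U
  unormD unormZ unorm_eq0 unorm_complete
  (@mulrA U) (fun l u v w => etrans (mulrDl _ _ _) (congr1 (fun t => t + _) (esym (uscaleAl l u w))))
  (fun l u v w => etrans (mulrDr _ _ _) (congr1 (fun t => t + _) (esym (uscaleAr l u v))))
  ustarK ustar_antilinear ustar_mul unorm_mul unorm_cstar.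

Definition uiota a : U := (a, 0).

Lemma nm_fst u : nm u.1 <= nm u + nm u.
Proof. exact: fst_unorm. Qed.

Lemma uiotaD a b : uiota (a + b) = uiota a + uiota b.
Proof. by apply: pairP => //=; rewrite addr0. Qed.

Lemma uiotaZ (l : R[i]) a : uiota (l *: a) = l *: uiota a.
Proof. by apply: pairP => //=; rewrite scaler0. Qed.

Lemma uiotaM a b : uiota (a ** b) = uiota a * uiota b.
Proof. by apply: pairP => /=; rewrite ?mul0r// !scale0r !addr0. Qed.

Lemma uiota_star a : uiota (star a) = star (uiota a).
Proof. by apply: pairP => //=; rewrite rmorph0. Qed.

Lemma uiota_inj : injective uiota.
Proof. by move=> a b []. Qed.

Lemma nm_uiota a : nm (uiota a) = nm a.
Proof.
rewrite [LHS](_ : _ = unorm (uiota a))//; apply/eqP; rewrite eq_le; apply/andP; split.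
  by apply: le_trans (unorm_fst _) _; rewrite /= nm0 addr0.
have [->|a0] := eqVneq a 0; first by rewrite nm0.
have ap := nm_gt0 a0.
rewrite -(ler_pM2r ap) -expr2.
have -> : nm a ^+ 2 = nm (a ** star a) by rewrite -(nm_star a) -nm_cstar starK.
rewrite [a ** _](_ : _ = uact (uiota a) (star a)); last by rewrite /uact /= scale0r addr0.
apply: le_trans (opP _ _) _; rewrite nm_star.
by apply: ler_wpM2r (op_unorm _); rewrite nm_ge0.
Qed.

Lemma uiotaB a b : uiota (a - b) = uiota a - uiota b.
Proof. by rewrite uiotaD; congr (_ + _); apply: pairP => //=; rewrite oppr0. Qed.

Lemma unit_mul_iota u a : u * uiota a = uiota (uact u a).
Proof. by apply: pairP => /=; rewrite ?mulr0// scale0r addr0. Qed.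

End Unitization.

(** * Order theory in the unitization *)

(* A reflexive decision procedure for identities in abelian groups. *)
Inductive zexpr := ZVar of nat | ZZero | ZAdd of zexpr & zexpr | ZOpp of zexpr.

Fixpoint zeval (V : zmodType) (env : seq V) e : V :=
  match e with
  | ZVar i => env`_i
  | ZZero => 0
  | ZAdd e1 e2 => zeval env e1 + zeval env e2
  | ZOpp e1 => - zeval env e1
  end.

Fixpoint zcoef (i : nat) e : int :=
  match e with
  | ZVar j => (i == j)%:Z
  | ZZero => 0
  | ZAdd e1 e2 => zcoef i e1 + zcoef i e2
  | ZOpp e1 => - zcoef i e1
  end.

Lemma zevalE (V : zmodType) (env : seq V) e :
  zeval env e = \sum_(i < size env) env`_i *~ zcoef i e.
Proof.
elim: e => [j||e1 IH1 e2 IH2|e1 IH1] /=.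
- have [jn|nj] := ltnP j (size env); last first.
    rewrite nth_default// big1// => i _.
    by rewrite ltn_eqF ?(leq_trans (ltn_ord i) nj).
  rewrite (bigD1 (Ordinal jn))//= eqxx big1 ?addr0// => i ij.
  by rewrite -val_eqE /= in ij; rewrite (negbTE ij).
- by rewrite big1.
- by rewrite IH1 IH2 -big_split; apply: eq_bigr => i _; rewrite mulrzDr.
- by rewrite IH1 -sumrN; apply: eq_bigr => i _; rewrite mulrNz.
Qed.

Lemma zmod_eq (V : zmodType) (env : seq V) e1 e2 :
  all (fun i => zcoef i e1 == zcoef i e2) (iota 0 (size env)) ->
  zeval env e1 = zeval env e2.
Proof.
move=> /allP h; rewrite !zevalE; apply: eq_bigr => i _.
by rewrite (eqP (h i _))// mem_iota ltn_ord.
Qed.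

Ltac zadd x l :=
  lazymatch l with
  | nil => constr:(x :: nil)
  | x :: _ => l
  | ?a :: ?t => let t' := zadd x t in constr:(a :: t')
  end.
Ltac zatoms e l :=
  lazymatch e with
  | GRing.zero => l
  | GRing.add ?a ?b => let l1 := zatoms a l in zatoms b l1
  | GRing.opp ?a => zatoms a l
  | _ => zadd e l
  end.
Ltac zidx x l :=
  lazymatch l with
  | x :: _ => constr:(O)
  | _ :: ?t => let n := zidx x t in constr:(S n)
  end.
Ltac zquote e l :=
  lazymatch e with
  | GRing.zero => constr:(ZZero)
  | GRing.add ?a ?b =>
      let a' := zquote a l in let b' := zquote b l in constr:(ZAdd a' b')
  | GRing.opp ?a => let a' := zquote a l in constr:(ZOpp a')
  | _ => let n := zidx e l in constr:(ZVar n)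
  end.
(* The atoms are abstracted up to conversion, since the same operation may be
   reached through different structures. *)
Ltac zabstract e :=
  lazymatch e with
  | GRing.zero => fail
  | GRing.add ?a ?b => first [zabstract a | zabstract b]
  | GRing.opp ?a => zabstract a
  | _ => tryif is_var e then fail
         else (let t := fresh "t" in set t := e; clearbody t)
  end.
Ltac zmod :=
  repeat lazymatch goal with
  | |- @eq _ ?a ?b => first [zabstract a | zabstract b]
  end;
  lazymatch goal with
  | |- @eq ?T ?a ?b =>
    let l0 := zatoms a (@nil T) in let l := zatoms b l0 in
    let a' := zquote a l in let b' := zquote b l in
    exact: (@zmod_eq _ l a' b')
  end.

(** The sets in which roots stay: the iterates leading to a root are polynomials without constant
    term in the given element. *)
Definition subalg {R : realType} {A : cstarAlgType R} (D : set A) : Prop :=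
  [/\ closed D, D 0, forall (a : R[i]) x y, D x -> D y -> D (a *: x + y)
    & forall x y, D x -> D y -> D (x ** y)].

Section SubalgTheory.
Context {R : realType} {A : cstarAlgType R} (D : set A).
Hypothesis hD : subalg D.

Lemma subalgD x y : D x -> D y -> D (x + y).
Proof. by case: hD => _ _ h _ Dx Dy; have := h 1 x y Dx Dy; rewrite scale1r. Qed.

Lemma subalgZ (a : R[i]) x : D x -> D (a *: x).
Proof. by case: hD => _ D0 h _ Dx; have := h a x 0 Dx D0; rewrite addr0. Qed.

Lemma subalgN x : D x -> D (- x).
Proof. by rewrite -scaleN1r; exact: subalgZ. Qed.

Lemma subalgM x y : D x -> D y -> D (x ** y).
Proof. by case: hD => _ _ _; exact. Qed.

End SubalgTheory.

Section Unital.
Context {R : realType} {A : cstarAlgType R}.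
Local Notation U := (unitz A).
Implicit Types (a b c s t u v w x y z : U).

Let amulE u v : u ** v = u * v. Proof. by []. Qed.

Lemma starM u v : star (u * v) = star v * star u.
Proof. exact: star_amul. Qed.

Lemma star1 : star (1 : U) = 1.
Proof. by rewrite -[LHS]mulr1 -[X in _ * X](starK (1 : U)) -starM mulr1 starK. Qed.

Lemma nmM u v : nm (u * v) <= nm u * nm v.
Proof. exact: nm_amul. Qed.

Lemma nm1 : nm (1 : U) = 1.
Proof.
have h : nm (1 : U) ^+ 2 = nm (1 : U) by rewrite -nm_cstar amulE star1 mulr1.
have n0 : nm (1 : U) != 0 by apply/negP => /eqP/nm_eq0/eqP; rewrite oner_eq0.
by apply: (mulfI n0); rewrite mulr1 -expr2.
Qed.

(** The element u = s + i a satisfies u^* u = 1, hence |u| <= 1, and [s], [a] are its real and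
    imaginary parts. This takes the place of spectral theory in every norm bound below. *)
Lemma circle s a : star s = s -> star a = a -> s * a = a * s ->
  s * s + a * a = 1 -> nm s <= 1 /\ nm a <= 1.
Proof.
move=> ss as_ sa h.
have uu : star (s + 'i *: a) * (s + 'i *: a) = 1.
  rewrite starD starZi ss as_ -h mulrDr !mulrDl -!scalerAr !mulNr -!scalerAl sa.
  rewrite scalerN scalerA -['i * 'i]expr2 sqr_i scaleN1r opprK.
  by rewrite addrA subrK.
have u1 : nm (s + 'i *: a) <= 1.
  by rewrite -(@ler_pXn2r _ 2) ?nnegrE ?nm_ge0// -nm_cstar amulE uu nm1 expr1n.
have su1 : nm (s - 'i *: a) <= 1 by rewrite -nm_star starB starZi ss as_ opprK.
have two (x : U) : nm (x + x) = nm x + nm x.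
  rewrite -mulr2n -[x *+ 2]scaler_nat -(rmorph_nat (real_complex R)) nmZr.
  by rewrite ger0_norm// mulr_natl mulr2n.
split.
  have : nm (s + s) <= 1 + 1.
    rewrite [s + s](_ : _ = (s + 'i *: a) + (s - 'i *: a)); last by rewrite addrACA subrr addr0.
    by apply: le_trans (nmD _ _) _; exact: lerD.
  by rewrite two; lra.
have : nm ('i *: a + 'i *: a) <= 1 + 1.
  rewrite [_ + _](_ : _ = (s + 'i *: a) - (s - 'i *: a)); last by zmod.
  by apply: le_trans (nmB _ _) _; exact: lerD.
by rewrite two nmZi; lra.
Qed.

(** The rational parametrisation of the circle: formally b = 2v / (1 + v^2), and 1 - b v = (1 - v^2)
    / (1 + v^2) is the other coordinate. *)
Lemma half_bound_unital b v : star b = b -> star v = v -> b * v = v * b ->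
  v + v = b + b * v * v -> nm b <= 1.
Proof.
move=> bs vs bv h.
have sbv : star (b * v) = b * v by rewrite starM bs vs bv.
have [] // := @circle (1 - b * v) b; first by rewrite starB star1 sbv.
  by rewrite mulrBl mulrBr mul1r mulr1 -mulrA -bv.
have -> : (1 - b * v) * (1 - b * v) + b * b =
    1 + b * (b + b * v * v - (v + v)).
  rewrite !(mulrBl, mulrBr, mulrDr, mul1r, mulr1).
  have -> : b * v * (b * v) = b * (b * v * v) by rewrite -!mulrA [v * (b * v)]mulrA -bv !mulrA.
  zmod.
by rewrite h subrr mulr0 addr0.
Qed.

(** Positivity without a spectrum: for self-adjoint x the inequality says that the spectrum lies in
    [0, 2t]. In this form sums of positive elements are positive by the triangle inequality. *)
Definition upos x : Prop :=
  star x = x /\ exists2 t : R, 0 < t & nm (t%:C *: 1 - x) <= t.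

Let closed_fst (D : set A) : closed D -> closed [set u : U | D u.1].
Proof.
move=> cD; apply/closedP => x hx; move/closedP: cD; apply => e e0.
have e2 : 0 < e / 2 by lra.
have [y Dy xy] := hx _ e2; exists y.1 => //.
by have := nm_fst (x - y); rewrite [(x - y).1]/=; lra.
Qed.

(** The fixed point for [q = 1] satisfies 2d = y + d^2, so (1 - d)^2 = 1 - y. The root has a scalar
    part while [D] is a subset of [A], hence membership is stated for first components. *)
Lemma sqrt_one_sub y : star y = y -> nm y <= 1 ->
  exists s, [/\ star s = s, s * s = 1 - y, nm (1 - s) <= 1,
    forall z, z * y = y * z -> z * s = s * z &
    forall D : set A, subalg D -> D y.1 -> D s.1].
Proof.
move=> ys y1.
have nm11 : nm (1 : U) <= 1 by rewrite nm1.
have [d [d1 dd hd]] := quadratic_fixpoint y1 nm11.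
rewrite !amulE mulr1 in dd.
exists (1 - d); split.
- suff ds : star d = d by rewrite starB star1 ds.
  apply: (hd [set d | star d = d]) => [||z zs]; [exact: closed_sa|exact: star0|].
  by rewrite !amulE mulr1 /= starZr starD ys starM zs.
- rewrite mulrBr !mulrBl mul1r mulr1 mul1r.
  have -> : d * d = d + d - y by rewrite dd addrC addKr.
  zmod.
- by rewrite opprB addrC subrK.
- move=> z zy; rewrite mulrBr mulrBl mulr1 mul1r; congr (_ - _); apply/esym.
  apply: (hd [set d | d * z = z * d]) => [||w /= wz]; first exact: closed_comm.
    by rewrite /= mul0r mulr0.
  rewrite !amulE mulr1 -scalerAl -scalerAr mulrDl mulrDr zy; congr (_ *: (_ + _)).
  by rewrite -mulrA wz mulrA wz mulrA.
- move=> D sD Dy; have [cD D0 _ _] := sD.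
  suff Dd : D d.1.
    by change (D (0 - d.1)); rewrite sub0r; apply: subalgN.
  apply: (hd [set u : U | D u.1]) => [||w Dw]; [exact: closed_fst|exact: D0|].
  change (D ((2^-1 : R)%:C *: (y.1 + (w * 1 * w).1))); rewrite mulr1.
  apply: subalgZ => //; apply: subalgD => //.
  change (D (w.1 ** w.1 + w.2 *: w.1 + w.2 *: w.1)).
  apply: subalgD => //; last exact: subalgZ.
  by apply: subalgD => //; [exact: subalgM|exact: subalgZ].
Qed.

Let comm_scale_one (t : R) z x : z * x = x * z ->
  z * (t%:C *: 1 - x) = (t%:C *: 1 - x) * z.
Proof. by move=> zx; rewrite mulrBr mulrBl -scalerAr -scalerAl mul1r mulr1 zx. Qed.

Lemma upos_sqrt x : upos x ->
  exists s, [/\ upos s, s * s = x,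
    forall z, z * x = x * z -> z * s = s * z &
    forall D : set A, subalg D -> D x.1 -> D s.1].
Proof.
move=> [xs [t t0 ht]].
(* Here x / t = 1 - y with y = 1 - x / t of norm at most 1; the root is then rescaled by sqrt t. *)
have [||s [ss s2 s1 sc sD]] := @sqrt_one_sub (1 - t^-1%:C *: x).
- by rewrite starB star1 starZr xs.
- rewrite (_ : 1 - _ = t^-1%:C *: (t%:C *: 1 - x)); last first.
    by rewrite scalerBr scalerA -rmorphM mulVf ?gt_eqF// scale1r.
  rewrite nmZr gtr0_norm ?invr_gt0//.
  by rewrite -(ler_pM2l t0) mulrA divff ?gt_eqF// mul1r mulr1.
have r0 : 0 < Num.sqrt t by rewrite sqrtr_gt0.
exists ((Num.sqrt t)%:C *: s); split.
- split; first by rewrite starZr ss.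
  exists (Num.sqrt t) => //; rewrite -scalerBr nmZr gtr0_norm//.
  by rewrite -[leRHS]mulr1 ler_pM2l.
- rewrite -scalerAl -scalerAr scalerA -rmorphM -expr2 sqr_sqrtr ?ltW// s2.
  by rewrite opprB addrC subrK scalerA -rmorphM divff ?gt_eqF// scale1r.
- move=> z zx; rewrite -scalerAl -scalerAr sc//.
  by rewrite mulrBr mulrBl mulr1 mul1r -scalerAl -scalerAr zx.
- move=> D sD' Dx; apply: subalgZ => //; apply: sD => //=.
  by rewrite sub0r; apply: subalgN => //; apply: subalgZ.
Qed.

(** After scaling to b = a / K, the elements s = sqrt(1 - b^2) and b lie on the circle, so |s| <= 1;
    and K^2 - a^2 = K^2 s^2. *)
Lemma sq_bound_unital a (K : R) : star a = a -> 0 < K -> nm a <= K ->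
  nm ((K ^+ 2)%:C *: 1 - a * a) <= K ^+ 2.
Proof.
move=> as_ K0 aK; pose b := (K^-1)%:C *: a.
have bs : star b = b by rewrite starZr as_.
have b1 : nm b <= 1.
  by rewrite nmZr gtr0_norm ?invr_gt0// mulrC ler_pdivrMr// mul1r.
have bb1 : nm (b * b) <= 1.
  by apply: le_trans (nmM _ _) _; rewrite -[leRHS]mulr1 ler_pM ?nm_ge0.
have [||s [ss s2 _ sc _]] := @sqrt_one_sub (b * b) => //.
  by rewrite starM bs.
have sb : s * b = b * s by rewrite [RHS]sc// mulrA.
have [s1 _] : nm s <= 1 /\ nm b <= 1 by apply: circle => //; rewrite s2 subrK.
have -> : (K ^+ 2)%:C *: 1 - a * a = (K ^+ 2)%:C *: (s * s).
  rewrite s2 scalerBr; congr (_ - _); rewrite -scalerAl -scalerAr !scalerA.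
  rewrite -!rmorphM /= [X in X%:C](_ : _ = 1) ?scale1r//.
  by field; rewrite gt_eqF.
rewrite nmZr ger0_norm ?sqr_ge0// -[leRHS]mulr1 ler_pM2l ?exprn_gt0//.
by apply: le_trans (nmM _ _) _; rewrite -[leRHS]mulr1 ler_pM ?nm_ge0.
Qed.

Lemma upos_sq a : star a = a -> upos (a * a).
Proof.
move=> as_; split; first by rewrite starM as_.
have K0 : 0 < nm a + 1 by have := nm_ge0 a; lra.
exists ((nm a + 1) ^+ 2); first by rewrite exprn_gt0.
by apply: sq_bound_unital => //; lra.
Qed.

Lemma uposD x y : upos x -> upos y -> upos (x + y).
Proof.
move=> [xs [t t0 ht]] [ys [r r0 hr]]; split; first by rewrite starD xs ys.
exists (t + r); first lra.
rewrite rmorphD scalerDl opprD addrACA.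
by apply: le_trans (nmD _ _) _; exact: lerD.
Qed.

Lemma upos_sub x (K : R) : star x = x -> 0 < K -> nm x <= K -> upos (K%:C *: 1 - x).
Proof.
move=> xs K0 xK; split; first by rewrite starB starZr star1 xs.
by exists K => //; rewrite opprB addrC subrK.
Qed.

(** If |x + y| <= K, then K - x = (K - (x + y)) + y is positive. Its root e and the root a of x
    satisfy a^2 + e^2 = K, and [circle] bounds |a|^2 by K. *)
Lemma upos_nm_le x y : upos x -> upos y -> nm x <= nm (x + y).
Proof.
move=> xp yp; rewrite leNgt; apply/negP => lt.
(* The midpoint, and not |x + y| itself, so that K > 0 even if x + y = 0. *)
pose K := (nm x + nm (x + y)) / 2.
have K0 : 0 < K by rewrite /K; have := nm_ge0 (x + y); lra.
have [a [ap a2 _ _]] := upos_sqrt xp.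
have hK : upos (K%:C *: 1 - x).
  rewrite (_ : _ - _ = (K%:C *: 1 - (x + y)) + y); last by rewrite opprD addrA subrK.
  apply: (uposD _ yp); apply: upos_sub => //; last by rewrite /K; lra.
  by rewrite starD xp.1 yp.1.
have [e [ep e2 ec _]] := upos_sqrt hK.
have ae : a * e = e * a by apply: ec; apply: comm_scale_one; rewrite -a2 mulrA.
have r0 : 0 < Num.sqrt K by rewrite sqrtr_gt0.
have scal u v : ((Num.sqrt K)^-1%:C *: u) * ((Num.sqrt K)^-1%:C *: v) = K^-1%:C *: (u * v).
  rewrite -scalerAl -scalerAr scalerA -rmorphM -expr2 exprVn sqr_sqrtr ?ltW//.
have [||||a1 _] := @circle ((Num.sqrt K)^-1%:C *: a) ((Num.sqrt K)^-1%:C *: e).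
- by rewrite starZr ap.1.
- by rewrite starZr ep.1.
- by rewrite !scal ae.
- by rewrite !scal a2 e2 -scalerDr addrC subrK scalerA -rmorphM mulVf ?gt_eqF// scale1r.
suff : nm x <= K by rewrite /K; lra.
rewrite nmZr gtr0_norm ?invr_gt0// mulrC ler_pdivrMr// mul1r in a1.
rewrite -a2; apply: le_trans (nmM _ _) _.
by rewrite -[leRHS](sqr_sqrtr (ltW K0)) expr2 ler_pM ?nm_ge0.
Qed.

Lemma upos_eq0 x y : upos x -> upos y -> x + y = 0 -> x = 0.
Proof.
move=> xp yp h; apply: nm_eq0; apply/eqP; rewrite eq_le nm_ge0 andbT.
by have := upos_nm_le xp yp; rewrite h nm0.
Qed.

(* Kaplansky's theorem.  With m = |x| for x = t^* t and w = m - x, the element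
   v = t w satisfies v^* v = - e^2; then z = v e has both z^* z and z z^*
   negative, whereas their sum is twice a sum of two squares, so that e = 0. *)
Lemma upos_star_mul t : upos (star t * t).
Proof.
set x := star t * t.
have xs : star x = x by rewrite /x starM starK.
have [m [mp m2 mc _]] := upos_sqrt (upos_sq xs).
have [n [np n2 nc _]] := upos_sqrt mp.
have ms := mp.1; have ns := np.1.
have xm : x * m = m * x by apply: mc; rewrite mulrA.
have xn : x * n = n * x by apply: nc.
have mn : m * n = n * m by rewrite -n2 mulrA.
pose w := m - x.
have ws : star w = w by rewrite /w starB ms xs.
have nw : n * w = w * n by rewrite /w mulrBr mulrBl xn mn.
have mw : m * w = w * m by rewrite /w mulrBr mulrBl xm.
have xw : x * w = - (m * w) by rewrite /w !mulrBr xm m2 opprB.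
have ww : w * w = m * w + m * w by rewrite {1}/w mulrBl xw opprK.
pose e := n * w.
have es : star e = e by rewrite /e starM ws ns.
pose v := t * w.
have vv : star v * v = - (e * e).
  rewrite /v starM ws mulrA -[w * star t * t]mulrA -/x -mulrA xw mulrN.
  by rewrite /e -n2 nw -[n * n * w]mulrA nw !mulrA.
pose f := v * star v.
have fs : star f = f by rewrite /f starM starK.
pose z := v * e.
have zz1 : star z * z = - ((e * e) * (e * e)).
  by rewrite /z starM es mulrA -[e * star v * v]mulrA vv mulrN mulNr !mulrA.
have zz2 : z * star z = - (f * f).
  rewrite /z starM es mulrA -[v * e * e]mulrA -[e * e]opprK -vv mulrN mulNr.
  by rewrite /f !mulrA.
have [h [k [hs ks zE _ _]]] := sa_decomp z.
have hk : star z * z + z * star z = (h * h + h * h) + (k * k + k * k).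
  rewrite zE starD starZi hs ks !(mulrDr, mulrDl, mulrBr, mulrBl, mulrN, mulNr).
  rewrite -!(scalerAl, scalerAr) !(scalerN, scalerA) -['i * 'i]expr2 sqr_i !scaleN1r.
  zmod.
have ee2 : e * e * (e * e) = 0.
  apply: (@upos_eq0 _ (f * f + ((h * h + h * h) + (k * k + k * k)))).
  - by apply: upos_sq; rewrite starM es.
  - by do 2?apply: uposD; do 2?apply: uposD; apply: upos_sq.
  - by rewrite -hk zz1 zz2; zmod.
have ee : e * e = 0 by apply: amul_sa0 => //; rewrite starM es.
have e0 : e = 0 by apply: amul_sa0.
have mw0 : m * w = 0 by rewrite -n2 -mulrA -/e e0 mulr0.
have w0 : w = 0 by apply: amul_sa0 => //; rewrite amulE ww mw0 addr0.
by move/subr0_eq: w0 => <-.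
Qed.

End Unital.

(** * Positive elements *)

Section Positivity.
Context {R : realType} {A : cstarAlgType R}.
Implicit Types (x y z b v : A).

Lemma half_bound b v : star b = b -> star v = v -> b ** v = v ** b ->
  v + v = b + b ** v ** v -> nm b <= 1.
Proof.
move=> bs vs bv h; rewrite -nm_uiota; apply: (@half_bound_unital _ _ _ (uiota v)).
- by rewrite -uiota_star bs.
- by rewrite -uiota_star vs.
- by rewrite -!uiotaM bv.
- by rewrite -uiotaD h uiotaD !uiotaM.
Qed.

(** The estimate that makes the iteration in [bounded_transform] a contraction. *)
Lemma sq_bound y z (K : R) : star y = y -> 0 < K -> nm y <= K ->
  nm ((K ^+ 2)%:C *: z - y ** y ** z) <= K ^+ 2 * nm z.
Proof.
move=> ys K0 yK; rewrite -[leLHS]nm_uiota.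
have -> : uiota ((K ^+ 2)%:C *: z - y ** y ** z) =
    ((K ^+ 2)%:C *: 1 - uiota y * uiota y) * uiota z.
  by rewrite uiotaB uiotaZ !uiotaM mulrBl -scalerAl mul1r.
apply: le_trans (nmM _ _) _; rewrite [nm (uiota z)]nm_uiota; apply: ler_wpM2r; first exact: nm_ge0.
by apply: sq_bound_unital; rewrite ?nm_uiota// -uiota_star ys.
Qed.

Lemma pos_upos x : pos x <-> upos (uiota x).
Proof.
split=> [[y ->]|xp]; first by rewrite uiotaM uiota_star; exact: upos_star_mul.
have [s [sp s2 _ _]] := upos_sqrt xp.
(* The scalar part of the root squares to that of [uiota x], which is 0, so the root already lies in
   [A]. *)
have /eqP : s.2 * s.2 = 0 by rewrite -[RHS](congr1 snd s2).
rewrite mulf_eq0 orbb => /eqP s0.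
have sE : s = uiota s.1 by case: (s) s0 => a l /= ->.
exists s.1; apply: uiota_inj; rewrite uiotaM uiota_star -sE -s2.
by rewrite sp.1.
Qed.

Lemma pos_sqrt x (D : set A) : pos x -> subalg D -> D x ->
  exists n, [/\ D n, star n = n & n ** n = x].
Proof.
move=> /pos_upos xp sD Dx; have [s [sp s2 _ hD]] := upos_sqrt xp.
have /eqP : s.2 * s.2 = 0 by rewrite -[RHS](congr1 snd s2).
rewrite mulf_eq0 orbb => /eqP s0.
have sE : s = uiota s.1 by case: (s) s0 => a l /= ->.
exists s.1; split; first exact: hD.
- by apply: uiota_inj; rewrite uiota_star -sE sp.1.
- by apply: uiota_inj; rewrite uiotaM -sE s2.
Qed.

Lemma posD x y : pos x -> pos y -> pos (x + y).
Proof. by rewrite !pos_upos uiotaD; exact: uposD. Qed.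

Lemma pos0 : pos (0 : A).
Proof. by exists 0; rewrite amulx0. Qed.

Lemma pos_sum (I : Type) (s : seq I) (P : pred I) (F : I -> A) :
  (forall i, P i -> pos (F i)) -> pos (\sum_(i <- s | P i) F i).
Proof. by move=> h; apply: (big_ind pos) => //; [exact: pos0|exact: posD]. Qed.

Lemma pos_star_mul x : pos (star x ** x).
Proof. by exists x. Qed.

Lemma pos_sa x : pos x -> star x = x.
Proof. by move=> [y ->]; rewrite star_amul starK. Qed.

Lemma pos_conj x z : pos x -> pos (star z ** x ** z).
Proof. by move=> [y ->]; exists (y ** z); rewrite star_amul !amulA. Qed.

Lemma pos_nm_le x y : pos x -> pos y -> nm x <= nm (x + y).
Proof.
by move=> /pos_upos xp /pos_upos yp; rewrite -(nm_uiota x) -(nm_uiota (x + y)) uiotaD; exact: upos_nm_le.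
Qed.

Lemma pos_eq0 x y : pos x -> pos y -> x + y = 0 -> x = 0.
Proof.
move=> xp yp h; apply: nm_eq0; apply/eqP; rewrite eq_le nm_ge0 andbT.
by have := pos_nm_le xp yp; rewrite h nm0.
Qed.

Lemma pos_conj_sub x z : pos x ->
  pos ((nm x)%:C *: (star z ** z) - star z ** x ** z).
Proof.
move=> xp; have [x0|x0] := eqVneq (nm x) 0.
  by rewrite (nm_eq0 x0) amulx0 amul0x subr0 nm0 scale0r; exact: pos0.
have x0' : 0 < nm x by rewrite lt_def x0 nm_ge0.
have [|s [sp s2 _ _]] := @upos_sqrt _ A ((nm x)%:C *: 1 - uiota x).
  by apply: upos_sub; rewrite ?nm_uiota// -uiota_star pos_sa.
(* The root [s] of |x| - x lives in the unitization, but [A] is an ideal there, so s z is an element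
   of [A]. *)
exists (uact s z); apply: uiota_inj.
rewrite uiotaM uiota_star -unit_mul_iota starM sp.1 -mulrA [s * _]mulrA s2.
rewrite mulrBl -scalerAl mul1r mulrBr -scalerAr.
by rewrite uiotaB uiotaZ !uiotaM uiota_star mulrA.
Qed.

End Positivity.

(** * Matrices over a C*-algebra *)

Section FiniteLimits.
Context {R : realType} {V : normedZmodType R[i]}.

Lemma lims_sum_nm (I : Type) (s : seq I) (u : I -> nat -> V) (l : I -> V) :
  (forall i, lims (u i) (l i)) ->
  forall e : R, 0 < e -> exists N, forall n, (N <= n)%N ->
    \sum_(i <- s) nm (u i n - l i) < e.
Proof.
move=> h; elim: s => [|i s IH] e e0; first by exists 0%N => n _; rewrite big_nil.
have e2 : 0 < e / 2 by lra.
have [N hN] := h i _ e2; have [M hM] := IH _ e2.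
exists (maxn N M) => n; rewrite geq_max big_cons => /andP[/hN {}hN /hM {}hM].
by have := ltrD hN hM; lra.
Qed.

End FiniteLimits.

(** * The Hilbert module of n-tuples over a C*-algebra *)

Section HilbertModule.
Context {R : realType} {A : cstarAlgType R} {n : nat}.
Local Notation vec := ('I_n -> A).
Implicit Types (v w : vec).

Definition ip v w : A := \sum_i star (v i) ** w i.
Definition vn v : R := Num.sqrt (nm (ip v v)).

Lemma ip_pos v : pos (ip v v).
Proof. by apply: pos_sum => i _; exact: pos_star_mul. Qed.

Lemma vn_ge0 v : 0 <= vn v.
Proof. exact: sqrtr_ge0. Qed.

Lemma vn_sqr v : vn v ^+ 2 = nm (ip v v).
Proof. by rewrite sqr_sqrtr ?nm_ge0. Qed.

Lemma nm_le_vn v i : nm (v i) <= vn v.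
Proof.
rewrite -(@ler_pXn2r _ 2) ?nnegrE ?nm_ge0 ?vn_ge0// vn_sqr -nm_cstar.
rewrite /ip (bigD1 i)//=; apply: pos_nm_le; first exact: pos_star_mul.
by apply: pos_sum => j _; exact: pos_star_mul.
Qed.

Lemma ip_star v w : star (ip v w) = ip w v.
Proof. by rewrite star_sum; apply: eq_bigr => i _; rewrite star_amul starK. Qed.

Lemma ipDl v v' w : ip (fun i => v i + v' i) w = ip v w + ip v' w.
Proof. by rewrite -big_split; apply: eq_bigr => i _; rewrite starD amulDl. Qed.

Lemma ipDr v w w' : ip v (fun i => w i + w' i) = ip v w + ip v w'.
Proof. by rewrite -big_split; apply: eq_bigr => i _; rewrite amulDr. Qed.

(** With a = <v, w>, l = |<v, v>| and u = v a - l w, positivity of <u, u> and a^* <v, v> a <= l a^*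
    a give l a^* a <= l^2 <w, w>. Monotonicity of the norm on positive elements finishes. *)
Lemma cauchy_schwarz v w : nm (ip v w) <= vn v * vn w.
Proof.
set a := ip v w; set l := nm (ip v v).
rewrite -(@ler_pXn2r _ 2) ?nnegrE ?mulr_ge0 ?nm_ge0 ?vn_ge0//.
rewrite exprMn !vn_sqr -/l -nm_cstar.
have [l0|l0] := eqVneq l 0.
  have v0 i : v i = 0.
    apply: nm_eq0; apply/eqP; rewrite eq_le nm_ge0 andbT.
    by apply: le_trans (nm_le_vn v i) _; rewrite /vn -/l l0 sqrtr0.
  rewrite /a /ip big1 => [|i _]; last by rewrite v0 star0 amul0x.
  by rewrite amulx0 nm0 mulr_ge0 ?nm_ge0.
have lp : 0 < l by rewrite lt_def l0 nm_ge0.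
pose u i := v i ** a - l%:C *: w i.
have uE : ip u u = star a ** ip v v ** a - l%:C *: (star a ** a)
    - l%:C *: (star a ** a) + (l ^+ 2)%:C *: ip w w.
  have -> : ip u u = \sum_i (star a ** (star (v i) ** v i) ** a
      - l%:C *: (star a ** (star (v i) ** w i))
      - l%:C *: (star (w i) ** v i ** a) + (l ^+ 2)%:C *: (star (w i) ** w i)).
    apply: eq_bigr => i _; rewrite /u starB star_amul starZr amulBr !amulBl !amulZl !amulZr.
    rewrite scalerA -rmorphM -expr2 !amulA opprB; zmod.
  rewrite !big_split /= !sumrN -!scaler_sumr -amul_suml -!amul_sumr -amul_suml.
  by rewrite -/(ip v v) -/(ip v w) -/(ip w v) -/(ip w w) -/a -(ip_star v w) -/a.
have p1 : pos ((l ^+ 2)%:C *: ip w w - l%:C *: (star a ** a)).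
  have := posD (ip_pos u) (pos_conj_sub a (ip_pos v)); rewrite uE -/l.
  by congr pos; zmod.
have p2 : pos (l%:C *: (star a ** a)).
  exists ((Num.sqrt l)%:C *: a).
  by rewrite starZr amulZl amulZr scalerA -rmorphM -expr2 sqr_sqrtr ?ltW.
have := pos_nm_le p2 p1; rewrite addrC subrK !nmZr gtr0_norm// ger0_norm ?sqr_ge0//.
by rewrite expr2 -mulrA ler_pM2l.
Qed.

Lemma vnD v w : vn (fun i => v i + w i) <= vn v + vn w.
Proof.
rewrite -(@ler_pXn2r _ 2) ?nnegrE ?addr_ge0 ?vn_ge0// vn_sqr ipDl !ipDr.
apply: le_trans (nmD _ _) _; apply: le_trans (lerD (nmD _ _) (nmD _ _)) _.
have := cauchy_schwarz v w; have := cauchy_schwarz w v.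
by rewrite -!vn_sqr; lra.
Qed.

Lemma vnZ (a : R[i]) v : vn (fun i => a *: v i) = nm a * vn v.
Proof.
rewrite /vn [ip _ _](_ : _ = (a^*%R * a) *: ip v v).
  rewrite nmZ nmM_scalar (_ : nm a^*%R = nm a); last by rewrite /nm norm_conjC.
  by rewrite -expr2 sqrtrM ?sqr_ge0// sqrtr_sqr ger0_norm ?nm_ge0.
rewrite scaler_sumr; apply: eq_bigr => i _.
by rewrite starZ amulZl amulZr scalerA.
Qed.

Lemma vn_le v : vn v <= \sum_i nm (v i).
Proof.
have s0 : 0 <= \sum_i nm (v i) by apply: sumr_ge0 => i _; exact: nm_ge0.
rewrite -(@ler_pXn2r _ 2) ?nnegrE ?vn_ge0// vn_sqr.
apply: le_trans (nm_sum _ _ _) _; rewrite expr2 mulr_suml; apply: ler_sum => i _.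
rewrite nm_cstar expr2; apply: ler_wpM2l; first exact: nm_ge0.
by rewrite (bigD1 i)//= lerDl; apply: sumr_ge0 => j _; exact: nm_ge0.
Qed.

End HilbertModule.

(** The alias keeps the operator norm on the Hilbert module apart from other structures on
    matrices. *)
Definition cmat (R : realType) (A : cstarAlgType R) (n : nat) : Type := 'M[A]_n.

Section MatrixAlgebra.
Context {R : realType} {A : cstarAlgType R} {n : nat}.
Local Notation M := (cmat A n).
Local Notation vec := ('I_n -> A).
Implicit Types (X Y : M) (v w : vec).

HB.instance Definition _ := GRing.Zmodule.copy M 'M[A]_n.

Definition cmat_scale (a : R[i]) X : M := \matrix_(i, j) (a *: X i j).

Let scaleA (a b : R[i]) X : cmat_scale a (cmat_scale b X) = cmat_scale (a * b) X.
Proof. by apply/matrixP => i j; rewrite !mxE scalerA. Qed.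
Let scale1 : left_id 1 cmat_scale.
Proof. by move=> X; apply/matrixP => i j; rewrite !mxE scale1r. Qed.
Let scaleDr : right_distributive cmat_scale +%R.
Proof. by move=> a X Y; apply/matrixP => i j; rewrite !mxE scalerDr. Qed.
Let scaleDl X : {morph cmat_scale^~ X : a b / a + b}.
Proof. by move=> a b; apply/matrixP => i j; rewrite !mxE scalerDl. Qed.

HB.instance Definition _ := GRing.Zmodule_isLmodule.Build R[i] M
  scaleA scale1 scaleDr scaleDl.

Definition mact X v : vec := fun i => \sum_k X i k ** v k.
Definition mnorm X : R := opn vn vn (mact X).

Let mact_bound X v : vn (mact X v) <= (\sum_i \sum_k nm (X i k)) * vn v.
Proof.
apply: le_trans (vn_le _) _; rewrite mulr_suml; apply: ler_sum => i _.
apply: le_trans (nm_sum _ _ _) _; rewrite mulr_suml; apply: ler_sum => k _.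
apply: le_trans (nm_amul _ _) _; apply: ler_wpM2l; first exact: nm_ge0.
exact: nm_le_vn.
Qed.

Let mnormP X v : vn (mact X v) <= mnorm X * vn v.
Proof. exact: opnP vn_ge0 _ _ _ (mact_bound X). Qed.

Let mnorm_le X K : 0 <= K -> (forall v, vn (mact X v) <= K * vn v) -> mnorm X <= K.
Proof. exact: opn_le. Qed.

Let mnorm_ge0 X : 0 <= mnorm X.
Proof. exact: opn_ge0. Qed.

Let mnorm_sum X : mnorm X <= \sum_i \sum_k nm (X i k).
Proof.
apply: mnorm_le (mact_bound X).
by apply: sumr_ge0 => i _; apply: sumr_ge0 => k _; exact: nm_ge0.
Qed.

Let mnorm_entry X i j : nm (X i j) <= mnorm X.
Proof.
have [->|x0] := eqVneq (X i j) 0; first by rewrite nm0.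
have xp := nm_gt0 x0.
(* [A] may lack an identity, so the test vector carries the adjoint of the entry in place of 1. *)
pose v k : A := if k == j then star (X i j) else 0.
have v1 : vn v = nm (X i j).
  rewrite /vn /ip (bigD1 j)//= big1 => [|k kj]; last by rewrite /v (negbTE kj) amulx0.
  by rewrite addr0 /v eqxx nm_cstar sqrtr_sqr ger0_norm ?nm_ge0// nm_star.
rewrite -(ler_pM2r xp) -{3}v1; apply: le_trans (mnormP X v).
apply: le_trans (nm_le_vn _ i); rewrite /mact (bigD1 j)//= big1 => [|k kj]; last first.
  by rewrite /v (negbTE kj) amulx0.
rewrite addr0 /v eqxx -expr2.
by rewrite -[X in X ^+ 2](nm_star (X i j)) -nm_cstar starK.
Qed.

Lemma mactD X Y v : mact (X + Y) v = fun i => mact X v i + mact Y v i.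
Proof.
apply/funext => i; rewrite -big_split; apply: eq_bigr => k _.
by rewrite mxE amulDl.
Qed.

Lemma mactZ (a : R[i]) X v : mact (a *: X) v = fun i => a *: mact X v i.
Proof.
apply/funext => i; rewrite scaler_sumr; apply: eq_bigr => k _.
by rewrite mxE amulZl.
Qed.

Lemma mactM X Y v : mact (matmul X Y) v = mact X (mact Y v).
Proof.
apply/funext => i; rewrite /mact.
under eq_bigr do rewrite mxE amul_suml.
rewrite exchange_big; apply: eq_bigr => k _.
by rewrite amul_sumr; apply: eq_bigr => j _; rewrite amulA.
Qed.

Lemma mact_adj X v w : ip (mact X v) w = ip v (mact (matstar X) w).
Proof.
rewrite /ip /mact.
under eq_bigr do rewrite star_sum amul_suml.
rewrite exchange_big; apply: eq_bigr => k _.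
by rewrite amul_sumr; apply: eq_bigr => j _; rewrite mxE star_amul amulA.
Qed.

Let mnormD X Y : mnorm (X + Y) <= mnorm X + mnorm Y.
Proof.
apply: mnorm_le => [|v]; first by rewrite addr_ge0.
by rewrite mactD mulrDl; apply: le_trans (vnD _ _) _; apply: lerD; exact: mnormP.
Qed.

Let mnormZ_le (a : R[i]) X : mnorm (a *: X) <= nm a * mnorm X.
Proof.
apply: mnorm_le => [|v]; first by rewrite mulr_ge0 ?nm_ge0.
rewrite mactZ vnZ -mulrA; apply: ler_wpM2l; first exact: nm_ge0.
exact: mnormP.
Qed.

Let mnormZ (a : R[i]) X : mnorm (a *: X) = nm a * mnorm X.
Proof.
apply/eqP; rewrite eq_le mnormZ_le /=.
have [->|a0] := eqVneq a 0; first by rewrite nm0 mul0r.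
have ap := nm_gt0 a0.
rewrite -ler_pdivlMl// -[X in mnorm X <= _]scale1r -[1](mulVf a0) -scalerA.
by apply: le_trans (mnormZ_le _ _) _; rewrite nmV.
Qed.

Let mnorm_eq0 X : mnorm X = 0 -> X = 0.
Proof.
move=> X0; apply/matrixP => i j; rewrite mxE; apply: nm_eq0; apply/eqP.
by rewrite eq_le nm_ge0 andbT -X0 mnorm_entry.
Qed.

Let mnorm_complete (s : nat -> M) :
  (forall e : R, 0 < e -> exists N, forall m k, (N <= m)%N -> (N <= k)%N ->
       mnorm (s m - s k) < e) ->
    exists L, forall e : R, 0 < e -> exists N, forall k, (N <= k)%N ->
       mnorm (s k - L) < e.
Proof.
move=> hs.
have ex (ij : 'I_n * 'I_n) : exists l, lims (fun k => s k ij.1 ij.2) l.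
  apply: complete_lims => e /hs[N hN]; exists N => m k Nm Nk.
  apply: le_lt_trans (hN _ _ Nm Nk).
  by have := mnorm_entry (s m - s k) ij.1 ij.2; rewrite !mxE.
have [l hl] := choice ex.
exists (\matrix_(i, j) l (i, j)) => e e0.
have [N hN] := lims_sum_nm (index_enum _) hl e0.
exists N => k /hN; apply: le_lt_trans; apply: le_trans (mnorm_sum _) _.
rewrite pair_big /=; apply: ler_sum => -[i j] _ /=.
by rewrite !mxE.
Qed.

Let mmulA : associative (@matmul R A n).
Proof.
move=> X Y Z; apply/matrixP => i j; rewrite !mxE.
under [LHS]eq_bigr do rewrite mxE amul_sumr.
under [RHS]eq_bigr do rewrite mxE amul_suml.
rewrite exchange_big; apply: eq_bigr => k _; apply: eq_bigr => l _.
by rewrite amulA.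
Qed.

Let mmul_linearl (a : R[i]) X Y Z :
  matmul (a *: X + Y) Z = a *: (matmul X Z : M) + matmul Y Z.
Proof.
apply/matrixP => i j; rewrite !mxE scaler_sumr -big_split; apply: eq_bigr => k _.
by rewrite !mxE amul_linearl.
Qed.

Let mmul_linearr (a : R[i]) X Y Z :
  matmul X (a *: Y + Z) = a *: (matmul X Y : M) + matmul X Z.
Proof.
apply/matrixP => i j; rewrite !mxE scaler_sumr -big_split; apply: eq_bigr => k _.
by rewrite !mxE amul_linearr.
Qed.

Let mstarK : involutive (@matstar R A n).
Proof. by move=> X; apply/matrixP => i j; rewrite !mxE starK. Qed.

Let mstar_antilinear (a : R[i]) X Y :
  matstar (a *: X + Y) = a^*%R *: (matstar X : M) + matstar Y.
Proof. by apply/matrixP => i j; rewrite !mxE star_antilinear. Qed.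

Let mstar_mul X Y : matstar (matmul X Y) = matmul (matstar Y) (matstar X).
Proof.
apply/matrixP => i j; rewrite !mxE star_sum; apply: eq_bigr => k _.
by rewrite !mxE star_amul.
Qed.

Let mnorm_mul X Y : mnorm (matmul X Y) <= mnorm X * mnorm Y.
Proof.
apply: mnorm_le => [|v]; first by rewrite mulr_ge0.
rewrite mactM; apply: le_trans (mnormP _ _) _; rewrite -mulrA.
by apply: ler_wpM2l.
Qed.

(** |X v|^2 = |<v, X^* X v>| by [mact_adj], and Cauchy-Schwarz bounds the right-hand side. *)
Let mnorm_sqr_le X : mnorm X ^+ 2 <= mnorm (matmul (matstar X) X).
Proof.
have h : mnorm X <= Num.sqrt (mnorm (matmul (matstar X) X)).
  apply: mnorm_le => [|v]; first exact: sqrtr_ge0.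
  rewrite -(@ler_pXn2r _ 2) ?nnegrE ?mulr_ge0 ?vn_ge0 ?sqrtr_ge0//.
  rewrite exprMn [Num.sqrt (mnorm _) ^+ 2]sqr_sqrtr// vn_sqr mact_adj -mactM.
  apply: le_trans (cauchy_schwarz _ _) _; rewrite mulrC expr2 mulrA.
  by apply: ler_wpM2r; rewrite ?vn_ge0.
rewrite -[leRHS]sqr_sqrtr//; apply: lerXn2r h; rewrite ?nnegrE ?sqrtr_ge0//.
Qed.

Let mnorm_cstar X : mnorm (matmul (matstar X) X) = mnorm X ^+ 2.
Proof.
have h Y : mnorm Y <= mnorm (matstar Y).
  have [->|v0] := eqVneq (mnorm Y) 0; first exact: mnorm_ge0.
  have vp : 0 < mnorm Y by rewrite lt_def v0 mnorm_ge0.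
  rewrite -(ler_pM2r vp) -expr2.
  exact: le_trans (mnorm_sqr_le _) (mnorm_mul _ _).
apply/eqP; rewrite eq_le mnorm_sqr_le andbT.
apply: le_trans (mnorm_mul _ _) _; rewrite expr2; apply: ler_wpM2r => //.
by rewrite -{2}[X]mstarK h.
Qed.

HB.instance Definition _ := Lmodule_isCStarAlgebra.Build R M
  mnormD mnormZ mnorm_eq0 mnorm_complete mmulA mmul_linearl mmul_linearr
  mstarK mstar_antilinear mstar_mul mnorm_mul mnorm_cstar.

Lemma nm_entry X i j : nm (X i j) <= nm X.
Proof. exact: mnorm_entry. Qed.

(** The product and adjoint of [cmat] are [matmul] and [matstar] by definition, so matrix positivity
    is positivity in this C*-algebra, and its square roots are available. *)
Lemma matposP X : matpos X <-> pos X.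
Proof. by []. Qed.

Lemma cmat_scaleE (a : R[i]) X i j : (a *: X) i j = a *: X i j.
Proof. by rewrite mxE. Qed.

Lemma closed_cmat (D : set A) :
  closed D -> closed [set X : M | forall i j, D (X i j)].
Proof.
move=> /closedP cD; apply/closedP => X hX i j; apply: cD => e e0.
have [Y DY XY] := hX _ e0; exists (Y i j); first exact: DY.
by apply: le_lt_trans XY; have := nm_entry (X - Y) i j; rewrite !mxE.
Qed.

Lemma subalg_cmat (D : set A) :
  subalg D -> subalg [set X : M | forall i j, D (X i j)].
Proof.
move=> sD; have [cD D0 DL _] := sD; split.
- exact: closed_cmat.
- by move=> i j; rewrite mxE.
- by move=> a X Y DX DY i j; rewrite mxE cmat_scaleE; exact: DL.
- move=> X Y DX DY i j; rewrite mxE; apply: (big_ind D) => // [x y|k _].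
    exact: subalgD.
  exact: subalgM.
Qed.

End MatrixAlgebra.

(** * Ternary morphisms *)

Section Spans.
Context {R : realType} {V : normedModType R[i]}.
Implicit Types (S X : set V).

Definition linset S : Prop :=
  S 0 /\ forall (a : R[i]) x y, S x -> S y -> S (a *: x + y).

Lemma submod_closedP S : submod_closed (mem S) <-> linset S.
Proof.
split=> [[S0 SL]|[S0 SL]]; split.
- by move: S0; rewrite inE.
- by move=> a x y Sx Sy; have := SL a x y; rewrite !inE; apply.
- by rewrite inE.
- by move=> a x y; rewrite !inE; exact: SL.
Qed.

Lemma linsetD S x y : linset S -> S x -> S y -> S (x + y).
Proof. by move=> [_ SL] Sx Sy; have := SL 1 x y Sx Sy; rewrite scale1r. Qed.

Lemma linsetZ S (a : R[i]) x : linset S -> S x -> S (a *: x).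
Proof. by move=> [S0 SL] Sx; have := SL a x 0 Sx S0; rewrite addr0. Qed.

Lemma linsetN S x : linset S -> S x -> S (- x).
Proof. by move=> lS Sx; rewrite -scaleN1r; exact: linsetZ. Qed.

Lemma linsetB S x y : linset S -> S x -> S y -> S (x - y).
Proof. by move=> lS Sx Sy; apply: linsetD => //; exact: linsetN. Qed.

Definition span X : set V := smallest (fun S : set V => submod_closed (mem S)) X.

Lemma span_min X S : linset S -> X `<=` S -> span X `<=` S.
Proof. by move=> lS XS x; apply; split => //; apply/submod_closedP. Qed.

Lemma sub_span X : X `<=` span X.
Proof. by move=> x Xx S [_]; exact. Qed.

Lemma linset_span X : linset (span X).
Proof.
split=> [S [/submod_closedP[]]//|a x y hx hy S hS].
by have [/submod_closedP[_ SL] _] := hS; apply: SL; [exact: hx|exact: hy].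
Qed.

Lemma linset_closure S : linset S -> linset (closure S).
Proof.
move=> [S0 SL]; split; first exact: subset_closure.
move=> a x y /closure_lims[u uS ux] /closure_lims[v vS vy].
apply: (closed_lims (u := fun n => a *: u n + v n)).
- exact: closed_closure.
- by move=> n; apply: subset_closure; exact: SL.
- by apply: limsD vy; exact: limsZ.
Qed.

End Spans.

Section CspanClosure.
Context {R : realType} {C : cstarAlgType R}.
Implicit Types (S X Y Z : set C).

Lemma linset_cspan X : linset (cspan_closure X).
Proof. exact: linset_closure (linset_span X). Qed.

Lemma closed_cspan X : closed (cspan_closure X).
Proof. exact: closed_closure. Qed.

Lemma sub_cspan X : X `<=` cspan_closure X.
Proof. exact: subset_trans (@sub_span _ _ X) (@subset_closure _ _). Qed.

Lemma cspan_min X S : linset S -> closed S -> X `<=` S -> cspan_closure X `<=` S.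
Proof.
move=> lS cS XS x /closure_lims[u uX ux]; apply: closed_lims cS _ ux => n.
exact: span_min lS XS _ (uX n).
Qed.

Lemma linset_preimage (D : cstarAlgType R) (g : C -> D) (S : set D) :
  (forall a x y, g (a *: x + y) = a *: g x + g y) -> linset S -> linset (g @^-1` S).
Proof.
move=> gL [S0 SL]; split; last by move=> a x y /= Sx Sy; rewrite gL; exact: SL.
by have := gL (-1) 0 0; rewrite scaleN1r oppr0 addr0 scaleN1r addNr /preimage /= => ->.
Qed.

Lemma closed_preimage_lims (D : cstarAlgType R) (g : C -> D) (S : set D) :
  (forall u x, lims u x -> lims (g \o u) (g x)) -> closed S -> closed (g @^-1` S).
Proof.
move=> gl cS; apply/closedP => x hx.
have /closure_lims[u uS ux] : closure (g @^-1` S) x by apply/closureP.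
exact: closed_lims cS uS (gl _ _ ux).
Qed.

Lemma cspan_preimage X S (g : C -> C) :
  (forall a x y, g (a *: x + y) = a *: g x + g y) ->
  (forall u x, lims u x -> lims (g \o u) (g x)) ->
  linset S -> closed S -> (forall x, X x -> S (g x)) ->
  forall x, cspan_closure X x -> S (g x).
Proof.
move=> gL gl lS cS XS x; apply: (@cspan_min X (g @^-1` S)) => //.
- exact: linset_preimage.
- exact: closed_preimage_lims.
Qed.

Lemma cspan_mull X S y : linset S -> closed S -> (forall x, X x -> S (y ** x)) ->
  forall x, cspan_closure X x -> S (y ** x).
Proof.
by apply: cspan_preimage => [a x z|u x]; [exact: amul_linearr|exact: lims_amul_r].
Qed.

Lemma cspan_mulr X S y : linset S -> closed S -> (forall x, X x -> S (x ** y)) ->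
  forall x, cspan_closure X x -> S (x ** y).
Proof.
apply: (cspan_preimage (g := fun x => x ** y)) => [a x z|u x].
  exact: amul_linearl.
exact: lims_amul_l.
Qed.

Lemma cspan_star X S : linset S -> closed S -> (forall x, X x -> S (star x)) ->
  forall x, cspan_closure X x -> S (star x).
Proof.
move=> lS cS XS x; apply: (@cspan_min X (star @^-1` S)) => //.
- split; first by rewrite /preimage /= star0; case: lS.
  by move=> a u v /= Su Sv; rewrite star_antilinear; case: lS => _; apply.
- by apply: closed_preimage_lims => // u v; exact: lims_star.
Qed.

(** The elementwise form of [is_starTRO]: closedness reduces closed spans to generators, and since
    [Z] is self-adjoint the triple product can be written without an adjoint. *)
Definition stro Z : Prop :=
  [/\ closed Z, linset Z, forall x, Z x -> Z (star x)
    & forall x y z, Z x -> Z y -> Z z -> Z (x ** y ** z)].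

Lemma is_starTROP Z : is_starTRO Z <-> stro Z.
Proof.
split=> [[/submod_closedP lZ cZ sZ tZ]|[cZ lZ sZ tZ]]; split => //.
- by move=> x Zx; apply: sZ; exists x.
- move=> x y z Zx Zy Zz; apply: tZ; apply: sub_cspan; exists (x ** y); last by exists z.
  apply: sub_cspan; exists x => //; exists y => //.
  by exists (star y); [apply: sZ; exists y|exact: starK].
- exact/submod_closedP.
- by move=> _ [x Zx <-]; exact: sZ.
- apply: cspan_min => // _ [a ha [z Zz <-]].
  move: a ha; apply: cspan_mulr => // _ [x Zx [_ [y Zy <-] <-]].
  by apply: tZ => //; exact: sZ.
Qed.

End CspanClosure.

Section TROBasics.
Context {R : realType} {C : cstarAlgType R} (Z : set C).
Hypothesis hZ : stro Z.

Lemma stro_closed : closed Z. Proof. by case: hZ. Qed.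
Lemma stro_lin : linset Z. Proof. by case: hZ. Qed.
Lemma stro_star x : Z x -> Z (star x). Proof. by case: hZ => _ _ + _; apply. Qed.
Lemma stroT x y z : Z x -> Z y -> Z z -> Z (x ** y ** z).
Proof. by case: hZ => _ _ _; apply. Qed.

Lemma sq_mul x y : Z x -> Z y -> sqset Z (x ** y).
Proof. by move=> Zx Zy; apply: sub_cspan; exists x => //; exists y. Qed.

Lemma stro_mul_sq x a : Z x -> sqset Z a -> Z (x ** a).
Proof.
move=> Zx; apply: cspan_mull; [exact: stro_lin|exact: stro_closed|].
by move=> _ [y Zy [z Zz <-]]; rewrite amulA; exact: stroT.
Qed.

Lemma sq_mul_stro x a : Z x -> sqset Z a -> Z (a ** x).
Proof.
move=> Zx; apply: cspan_mulr; [exact: stro_lin|exact: stro_closed|].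
by move=> _ [y Zy [z Zz <-]]; exact: stroT.
Qed.

Lemma sq_star a : sqset Z a -> sqset Z (star a).
Proof.
apply: cspan_star; [exact: linset_cspan|exact: closed_cspan|].
by move=> _ [y Zy [z Zz <-]]; rewrite star_amul; apply: sq_mul; exact: stro_star.
Qed.

Lemma sqM a b : sqset Z a -> sqset Z b -> sqset Z (a ** b).
Proof.
move=> + hb; apply: cspan_mulr; [exact: linset_cspan|exact: closed_cspan|].
move=> _ [y Zy [z Zz <-]]; rewrite -amulA; apply: sq_mul => //.
exact: stro_mul_sq.
Qed.

Lemma sq_lin : linset (sqset Z). Proof. exact: linset_cspan. Qed.
Lemma sq_closed : closed (sqset Z). Proof. exact: closed_cspan. Qed.

End TROBasics.

Section StarSubalgebras.
Context {R : realType} {C : cstarAlgType R} (D : set C).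
Hypotheses (cD : closed D) (lD : linset D) (sD : forall x, D x -> D (star x))
  (mD : forall x y, D x -> D y -> D (x ** y)).

Lemma subalg_stro : stro D.
Proof. by split => // x y z Dx Dy Dz; do 2?apply: (mD) => //. Qed.

Lemma star_hom_ternary (B : cstarAlgType R) (f : C -> B) :
  star_hom D f -> ternary_star_morphism D f.
Proof.
move=> [lf mf]; split => // x y z Dx Dy Dz.
by rewrite !mf//; [rewrite lf.2|exact: sD|apply: mD => //; exact: sD].
Qed.

End StarSubalgebras.

(** * Boundedness of ternary *-morphisms *)

Section TernaryMorphism.
Context {R : realType} {C B : cstarAlgType R} (Z : set C) (f : C -> B).
Hypotheses (hZ : stro Z) (hf : ternary_star_morphism Z f).

Let Z0 : Z 0. Proof. by case: (stro_lin hZ). Qed.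
Let ZD x y : Z x -> Z y -> Z (x + y). Proof. exact: linsetD (stro_lin hZ). Qed.
Let ZZ (a : R[i]) x : Z x -> Z (a *: x). Proof. exact: linsetZ (stro_lin hZ). Qed.
Let ZB x y : Z x -> Z y -> Z (x - y). Proof. exact: linsetB (stro_lin hZ). Qed.
Let Zs x : Z x -> Z (star x). Proof. exact: stro_star. Qed.
Let ZT x y z : Z x -> Z y -> Z z -> Z (x ** y ** z). Proof. exact: stroT. Qed.

Lemma tmL (a : R[i]) x y : Z x -> Z y -> f (a *: x + y) = a *: f x + f y.
Proof. by case: hf => -[h _] _; exact: h. Qed.

Lemma tmS x : Z x -> f (star x) = star (f x).
Proof. by case: hf => -[_ h] _; exact: h. Qed.

Lemma tmT x y z : Z x -> Z y -> Z z -> f (x ** y ** z) = f x ** f y ** f z.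
Proof.
move=> Zx Zy Zz; case: hf => _ h; have := h x (star y) z Zx (Zs Zy) Zz.
by rewrite starK tmS// starK.
Qed.

Lemma tmD x y : Z x -> Z y -> f (x + y) = f x + f y.
Proof. by move=> Zx Zy; have := tmL 1 Zx Zy; rewrite !scale1r. Qed.

Lemma tm0 : f 0 = 0.
Proof. by apply: (addIr (f 0)); rewrite -tmD// !add0r. Qed.

Lemma tmZ (a : R[i]) x : Z x -> f (a *: x) = a *: f x.
Proof. by move=> Zx; have := tmL a Zx Z0; rewrite tm0 !addr0. Qed.

Lemma tmB x y : Z x -> Z y -> f (x - y) = f x - f y.
Proof. by move=> Zx Zy; have := tmL (-1) Zy Zx; rewrite !scaleN1r addrC [RHS]addrC. Qed.

(* The commutator c of f x and f y is annihilated by both of them, hence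
   c^* c = - c^2 = 0, although x y itself need not lie in the domain of f. *)
Lemma tm_comm x y : Z x -> Z y -> star x = x -> star y = y -> x ** y = y ** x ->
  f x ** f y = f y ** f x.
Proof.
move=> Zx Zy xs ys xy.
have bs : star (f x) = f x by rewrite -tmS// xs.
have vs : star (f y) = f y by rewrite -tmS// ys.
have e1 : f x ** f x ** f y = f x ** f y ** f x.
  by rewrite -!tmT//; congr f; rewrite -[LHS]amulA [in LHS]xy amulA.
have e2 : f y ** f x ** f y = f y ** f y ** f x.
  by rewrite -!tmT//; congr f; rewrite -[LHS]amulA [in LHS]xy amulA.
set c := f x ** f y - f y ** f x.
have bc : f x ** c = 0 by rewrite /c amulBr !amulA e1 subrr.
have vc : f y ** c = 0 by rewrite /c amulBr !amulA e2 subrr.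
have cs : star c = - c by rewrite /c starB !star_amul bs vs opprB.
apply/subr0_eq/cstar0; rewrite -/c cs amulNl {1}/c amulBl -!amulA bc vc !amulx0.
by rewrite subr0 oppr0.
Qed.

Lemma tm_bound_sa x : Z x -> star x = x -> nm x <= 1 -> nm (f x) <= 1.
Proof.
move=> Zx xs x1; have [y [_ yy hy]] := quadratic_fixpoint x1 x1.
have Zy : Z y.
  apply: hy => //; first exact: stro_closed.
  by move=> w Zw; apply: ZZ; apply: ZD => //; exact: ZT.
have ys : star y = y.
  apply: (hy [set w | star w = w]) => [||w /= ws]; [exact: closed_sa|exact: star0|].
  by rewrite starZr starD !star_amul ws xs amulA.
have xy : y ** x = x ** y.
  apply: (hy [set w | w ** x = x ** w]) => [||w /= wx]; first exact: closed_comm.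
    by rewrite /= amul0x amulx0.
  rewrite amulZl amulZr amulDl amulDr; congr (_ *: (_ + _)).
  by rewrite -[LHS]amulA {1 2}wx !amulA.
apply: (@half_bound _ _ _ (f y)).
- by rewrite -tmS// xs.
- by rewrite -tmS// ys.
- exact: tm_comm.
- rewrite -tmD// yy tmD//; last exact: ZT.
  by congr (_ + _); rewrite xy tmT.
Qed.

(** The bounds on [f u] and [f v] serve the lifting argument for closed images, where only the size
    of [f x] is under control. *)
Lemma sa_parts x : Z x -> exists u v, [/\ Z u /\ Z v, star u = u, star v = v,
  x = u + 'i *: v & [/\ nm u <= nm x, nm v <= nm x, nm (f u) <= nm (f x)
    & nm (f v) <= nm (f x)]].
Proof.
move=> Zx; have [u [v [us vs xE uE vE]]] := sa_decomp x.
have half0 (t : R) : `|2^-1 : R| * (t + t) = t by rewrite ger0_norm; lra.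
have hh (V : normedModType R[i]) (p q : V) (t : R) : nm p <= t -> nm q <= t ->
    nm ((2^-1)%:C *: (p + q)) <= t.
  move=> pt qt; rewrite nmZr -[leRHS]half0; apply: ler_wpM2l => //.
  by apply: le_trans (nmD _ _) _; exact: lerD.
have Zu : Z u by rewrite uE; apply: ZZ; apply: ZD => //; exact: Zs.
have Zv : Z v by rewrite vE; apply: ZZ; apply: ZB => //; exact: Zs.
have vE' : v = - 'i *: ((2^-1)%:C *: (x - star x)) by rewrite scalerA mulrC.
have nmi (V : normedModType R[i]) (p : V) : nm (- 'i *: p) = nm p.
  by rewrite scaleNr nmN nmZi.
exists u, v; split => //; split.
- by rewrite uE; apply: hh => //; rewrite nm_star.
- by rewrite vE' nmi; apply: hh => //; rewrite nmN nm_star.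
- rewrite uE tmZ ?tmD//; [|exact: Zs|by apply: ZD => //; exact: Zs].
  by apply: hh => //; rewrite tmS// nm_star.
- rewrite vE' tmZ; last by apply: ZZ; apply: ZB => //; exact: Zs.
  rewrite nmi tmZ ?tmB//; [|exact: Zs|by apply: ZB => //; exact: Zs].
  by apply: hh => //; rewrite nmN tmS// nm_star.
Qed.

(** The constant 2 counts the two self-adjoint parts. It suffices for continuity, and [good_bound]
    removes it by taking powers. *)
Lemma tm_bound x : Z x -> nm (f x) <= 2 * nm x.
Proof.
have sa u : Z u -> star u = u -> nm (f u) <= nm u.
  move=> Zu us; have [u0|u0] := eqVneq (nm u) 0.
    by rewrite (nm_eq0 u0) tm0 !nm0.
  have up : 0 < nm u by rewrite lt_def u0 nm_ge0.
  have := @tm_bound_sa ((nm u)^-1%:C *: u) (ZZ _ Zu).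
  rewrite starZr us tmZ// !nmZr gtr0_norm ?invr_gt0// mulVf//.
  by move=> /(_ erefl (lexx _)); rewrite mulrC ler_pdivrMr// mul1r.
move=> Zx; have [u [v [[Zu Zv] us vs -> [ux vx _ _]]]] := sa_parts Zx.
rewrite addrC tmL//; apply: le_trans (nmD _ _) _; rewrite nmZi.
have := sa _ Zu us; have := sa _ Zv vs.
by move: ux vx; rewrite [u + _]addrC; lra.
Qed.

Lemma tm_lims u x : (forall n, Z (u n)) -> Z x -> lims u x -> lims (f \o u) (f x).
Proof.
move=> Zu Zx; apply: (lims_lip (K := 2)) => n.
by rewrite -tmB//; apply: tm_bound; exact: ZB.
Qed.

End TernaryMorphism.

(** * Images of ternary morphisms *)

Section ClosedImage.
Context {R : realType} {C B : cstarAlgType R} (Z : set C) (f : C -> B).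
Hypotheses (hZ : stro Z) (hf : ternary_star_morphism Z f).

Let Z0 : Z 0. Proof. by case: (stro_lin hZ). Qed.
Let ZD x y : Z x -> Z y -> Z (x + y). Proof. exact: linsetD (stro_lin hZ). Qed.
Let ZZ (a : R[i]) x : Z x -> Z (a *: x). Proof. exact: linsetZ (stro_lin hZ). Qed.
Let ZB x y : Z x -> Z y -> Z (x - y). Proof. exact: linsetB (stro_lin hZ). Qed.
Let Zs x : Z x -> Z (star x). Proof. exact: stro_star. Qed.
Let ZT x y z : Z x -> Z y -> Z z -> Z (x ** y ** z). Proof. exact: stroT. Qed.

(* x is 2y / (1 + y^2), obtained by iterating a contraction. *)
Lemma bounded_transform y : Z y -> star y = y -> exists x,
  [/\ Z x, star x = x, x ** y = y ** x, y + y = x + y ** y ** x & nm x <= 1].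
Proof.
move=> Zy ys.
pose K := nm y + 1.
have K1 : 1 <= K by rewrite lerDr nm_ge0.
have K0 : 0 < K by lra.
have yK : nm y <= K by rewrite /K; lra.
pose c := (1 + K ^+ 2)^-1.
have K2 : 0 <= K ^+ 2 by rewrite sqr_ge0.
have c0 : 0 < c by rewrite invr_gt0; lra.
pose r := c * K ^+ 2.
have r0 : 0 <= r by rewrite mulr_ge0// ltW.
have cr : 1 - r = c by rewrite /r /c; field; rewrite gt_eqF//; lra.
(* A fixed point solves (1 + K^2) x = 2y + K^2 x - y^2 x, that is, 2y = x + y^2 x. By [sq_bound], x
   |-> K^2 x - y^2 x has norm at most K^2, so [F] is Lipschitz with constant r = K^2 / (1 + K^2) <
   1. *)
pose F x : C := c%:C *: ((y + y) + ((K ^+ 2)%:C *: x - y ** y ** x)).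
have Flip x x' : nm (F x - F x') <= r * nm (x - x').
  rewrite /F -scalerBr nmZr gtr0_norm// /r -mulrA ler_pM2l//.
  rewrite [X in nm X](_ : _ = (K ^+ 2)%:C *: (x - x') - y ** y ** (x - x')).
    exact: sq_bound.
  by rewrite scalerBr amulBr; zmod.
pose s n : C := iter n F 0.
pose L := nm (F 0).
have sstep n : nm (s n.+1 - s n) <= L * r ^+ n.
  elim: n => [|n IH]; first by rewrite /s /= subr0 expr0 mulr1.
  apply: le_trans (Flip _ _) _; rewrite exprS mulrCA.
  exact: ler_wpM2l.
have [|x sx] := @complete_lims _ C s.
  apply: (@cauchys_dominated _ _ _ (fun n => - (L / c * r ^+ n)) 0) => n.
    rewrite exprS (_ : _ - _ = L / c * (1 - r) * r ^+ n); last ring.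
    by rewrite cr mulfVK ?gt_eqF.
  by rewrite oppr_le0 mulr_ge0 ?exprn_ge0// divr_ge0 ?nm_ge0// ltW.
have inv (P : set C) : closed P -> P 0 -> (forall w, P w -> P (F w)) -> P x.
  by move=> cP P0 PF; apply: closed_lims cP _ sx; elim=> [|n IH] //; exact: PF.
have Fx : F x = x.
  apply: lims_unique (lims_shift sx).
  by apply: (@lims_lip _ _ _ F r s) => // n; exact: Flip.
have xE : y + y = x + y ** y ** x.
  have : (1 + K ^+ 2)%:C *: F x = (1 + K ^+ 2)%:C *: x by rewrite Fx.
  rewrite /F scalerA -rmorphM divff ?gt_eqF//; last lra.
  rewrite scale1r rmorphD scalerDl rmorph1 scale1r => h.
  by apply: (addIr ((K ^+ 2)%:C *: x - y ** y ** x)); rewrite h; zmod.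
have xs : star x = x.
  suff [] : star x = x /\ x ** y = y ** x by [].
  apply: (inv [set w | star w = w /\ w ** y = y ** w]) => [||w [ws wy]].
  - by apply: closedI; [exact: closed_sa|exact: closed_comm].
  - by rewrite /= star0 amul0x amulx0.
  - split.
      rewrite starZr !starD starN starZr !star_amul ws ys.
      by rewrite amulA wy -amulA wy amulA.
    rewrite amulZl amulZr; congr (_ *: _).
    rewrite amulDl amulDr amulDl amulDr amulBl amulBr amulZl amulZr wy.
    by rewrite -[y ** y ** w ** y]amulA wy !amulA.
have xy : x ** y = y ** x.
  apply: (inv [set w | w ** y = y ** w]) => [||w /= wy]; first exact: closed_comm.
    by rewrite /= amul0x amulx0.
  rewrite amulZl amulZr; congr (_ *: _).
  rewrite amulDl amulDr amulDl amulDr amulBl amulBr amulZl amulZr wy.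
  by rewrite -[y ** y ** w ** y]amulA wy !amulA.
exists x; split => //.
- apply: inv => // [|w Zw]; first exact: stro_closed.
  by apply: ZZ; apply: ZD; [exact: ZD|apply: ZB; [exact: ZZ|exact: ZT]].
- apply: (@half_bound _ _ _ y) => //.
  by rewrite xE xy -[y ** x ** y]amulA xy amulA.
Qed.

(** The norm of [u] is uncontrolled. Passing from y = u / (10 s) to x = 2y / (1 + y^2) truncates it
    to norm at most 1, while 2 f(y) and f(x) differ only by the cubic term f(y) f(y) f(x), of norm
    at most 1/100 because |f(y)| <= 1/10. The lift is 5 s x. *)
Lemma approx_lift_sa u (s : R) : Z u -> star u = u -> 0 < s -> nm (f u) <= s ->
  exists u', [/\ Z u', nm u' <= 5 * s & nm (f u - f u') <= s / 20].
Proof.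
move=> Zu us s0 us1.
pose k := (10 * s)^-1.
have k0 : 0 < k by rewrite invr_gt0; lra.
have ks : k * s = 10^-1 by rewrite /k; field; rewrite gt_eqF.
pose y := k%:C *: u.
have Zy : Z y by exact: ZZ.
have ys : star y = y by rewrite starZr us.
have [x [Zx xs xy yE x1]] := bounded_transform Zy ys.
have bs : star (f x) = f x by rewrite -(tmS hf)// xs.
have vs : star (f y) = f y by rewrite -(tmS hf)// ys.
have bv : f x ** f y = f y ** f x by apply: (tm_comm hZ hf).
have vE : f y + f y = f x + f y ** f y ** f x.
  rewrite -(tmD hf)// yE (tmD hf)//; last exact: ZT.
  by rewrite (tmT hZ hf).
have b1 : nm (f x) <= 1.
  apply: (@half_bound _ _ _ (f y)) => //.
  by rewrite vE bv -[f y ** f x ** f y]amulA bv amulA.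
have v1 : nm (f y) <= 10^-1.
  by rewrite (tmZ hZ hf)// nmZr gtr0_norm// -ks ler_pM2l.
have kk : ((2 * k)^-1)%:C *: (f y + f y) = f u.
  rewrite (tmZ hZ hf)// -scalerDl scalerA -rmorphD -rmorphM -[RHS]scale1r.
  by congr (_%:C *: _); field; rewrite gt_eqF.
have kI : 0 < (2 * k)^-1 by rewrite invr_gt0; lra.
have kE : (2 * k)^-1 = 5 * s by rewrite /k; field; rewrite gt_eqF.
exists (((2 * k)^-1)%:C *: x); split; first exact: ZZ.
  by rewrite nmZr gtr0_norm// kE -[leRHS]mulr1 ler_pM2l//; lra.
rewrite (tmZ hZ hf)// -kk -scalerBr nmZr gtr0_norm// vE addrC addKr kE.
suff : nm (f y ** f y ** f x) <= 100^-1 by move: s0; nra.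
apply: le_trans (nm_amul _ _) _.
apply: le_trans (_ : 10^-1 * 10^-1 * 1 <= _); last lra.
apply: ler_pM; rewrite ?nm_ge0//.
by apply: le_trans (nm_amul _ _) _; apply: ler_pM; rewrite ?nm_ge0.
Qed.

Let W : set B := f @` Z.

Let clW_lin : linset (closure W).
Proof.
apply: linset_closure; split; first by exists 0 => //; exact: (tm0 hZ hf).
move=> a _ _ [x Zx <-] [y Zy <-]; exists (a *: x + y); last exact: (tmL hf).
by apply: ZD => //; exact: ZZ.
Qed.

(** Some f(z0) lies within t/4 of r, so |f(z0)| <= 5t/4. Lifting its two self-adjoint parts costs 2
    * 5 * 5t/4 <= 13t in norm, and the total error is at most t/4 + 2 * (5t/4)/20 <= t/2. *)
Lemma approx_lift r (t : R) : closure W r -> 0 < t -> nm r <= t ->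
  exists z, [/\ Z z, nm z <= 13 * t & nm (r - f z) <= t / 2].
Proof.
move=> /closureP cr t0 rt.
have t4 : 0 < t / 4 by lra.
have [_ [z0 Zz0 <-] z0r] := cr _ t4.
have z0t : nm (f z0) <= 5 / 4 * t.
  by have := nm_le_dist (f z0) r; move: z0r; rewrite (nmC r); lra.
have [u [v [[Zu Zv] us vs zE [_ _ fu fv]]]] := sa_parts hZ hf Zz0.
have s0 : 0 < 5 / 4 * t by lra.
have [u' [Zu' u1 u2]] := approx_lift_sa Zu us s0 (le_trans fu z0t).
have [v' [Zv' v1 v2]] := approx_lift_sa Zv vs s0 (le_trans fv z0t).
exists ('i *: v' + u'); split; first by apply: ZD => //; exact: ZZ.
- by apply: le_trans (nmD _ _) _; rewrite nmZi; lra.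
- apply: le_trans (nm_tri (f z0) _ _) _.
  rewrite (tmL hf)// zE [u + _]addrC (tmL hf)//.
  rewrite [X in _ + nm X](_ : _ = 'i *: (f v - f v') + (f u - f u')); last first.
    by rewrite scalerBr; zmod.
  have := nmD ('i *: (f v - f v')) (f u - f u'); rewrite nmZi.
  by move: z0r; rewrite zE [u + _]addrC (tmL hf)//; lra.
Qed.

Lemma closed_image : closed W.
Proof.
apply/closedP => w hw; have cw : closure W w by apply/closureP.
(* Totalised over all pairs, with value 0 where the conditions fail, so that [choice] yields a
   function. *)
have ex (p : B * R) : exists z, closure W p.1 -> 0 < p.2 -> nm p.1 <= p.2 ->
    [/\ Z z, nm z <= 13 * p.2 & nm (p.1 - f z) <= p.2 / 2].
  have [[h1 h2 h3]|h] := pselect [/\ closure W p.1, 0 < p.2 & nm p.1 <= p.2].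
    by have [z hz] := approx_lift h1 h2 h3; exists z.
  by exists 0 => h1 h2 h3; case: h; split.
have [G hG] := choice ex.
pose T := nm w + 1.
have T0 : 0 < T by have := nm_ge0 w; rewrite /T; lra.
(* A state consists of the remaining target, its tolerance and the partial lift. Each round halves
   the tolerance, as in the proof of the open mapping theorem. *)
pose step (q : B * R * C) : B * R * C :=
  (q.1.1 - f (G q.1), q.1.2 / 2, q.2 + G q.1).
pose q n := iter n step (w, T, 0).
have hq n : [/\ closure W (q n).1.1, 0 < (q n).1.2, nm (q n).1.1 <= (q n).1.2,
    Z (q n).2 & f (q n).2 = w - (q n).1.1].
  elim: n => [|n [h1 h2 h3 h4 h5]].
    by split => //=; [rewrite /T; lra|rewrite subrr (tm0 hZ hf)].
  have [g1 g2 g3] := hG _ h1 h2 h3.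
  split => /=; [|lra|exact: g3|exact: ZD|].
    by apply: (linsetB clW_lin) => //; apply: subset_closure; exists (G (q n).1).
  by rewrite (tmD hf)// h5; zmod.
have [|z qz] := @complete_lims _ C (fun n => (q n).2).
  (* A lift at tolerance t has norm at most 13 t = 26 t - 26 (t / 2). *)
  apply: (@cauchys_dominated _ _ _ (fun n => - (26 * (q n).1.2)) 0) => n.
    have [h1 h2 h3 h4 h5] := hq n; have [g1 g2 g3] := hG _ h1 h2 h3.
    by rewrite /= addrC addKr; lra.
  by have [_ h _ _ _] := hq n; lra.
have Zz : Z z by apply: closed_lims (stro_closed hZ) _ qz => n; have [] := hq n.
exists z => //.
apply: lims_unique (tm_lims hZ hf _ Zz qz) _; first by move=> n; have [] := hq n.
move=> e e0.
have tn n : (q n).1.2 * n.+1%:R <= T.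
  elim: n => [|n IH]; first by rewrite mulr1.
  apply: le_trans IH => /=; have [_ h _ _ _] := hq n.
  rewrite -mulrA ler_pM2l// -[n.+2]addn1 natrD.
  have : (1 : R) <= n.+1%:R by rewrite ler1n.
  lra.
exists (Num.truncn (T / e)) => n Nn /=.
have [_ h2 h3 _ ->] := hq n.
rewrite addrC addKr nmN; apply: le_lt_trans h3 _.
have n0 : (0 : R) < n.+1%:R by rewrite ltr0n.
rewrite -(ltr_pM2r n0); apply: le_lt_trans (tn n) _.
rewrite mulrC -ltr_pdivrMr//; apply: lt_le_trans (truncnS_gt _) _.
by rewrite ler_nat.
Qed.

End ClosedImage.

(** * The associated *-homomorphism *)

(** An elementary form of K^(1/n) -> 1: if y < x, the powers of x / y are unbounded by Bernoulli's
    inequality, whereas the hypothesis keeps them below K / x. *)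
Lemma le_of_exp_le (R : realType) (x y K : R) : 0 <= x -> 0 <= y ->
  (forall n, x ^+ n.+2 <= K * y ^+ n.+1) -> x <= y.
Proof.
move=> x0 y0 h; rewrite leNgt; apply/negP => yx.
have xp : 0 < x by exact: le_lt_trans yx.
have [y00|yn0] := eqVneq y 0.
  by have := h 0%N; rewrite y00 expr1 mulr0 leNgt exprn_gt0.
have yp : 0 < y by rewrite lt_def yn0.
pose q := x / y - 1.
have q0 : 0 < q by rewrite subr_gt0 ltr_pdivlMr// mul1r.
have bern n : 1 + q *+ n <= (x / y) ^+ n.
  have -> : x / y = 1 + q by rewrite /q addrC subrK.
  elim: n => [|n IH]; first by rewrite mulr0n addr0 expr0.
  rewrite exprSr; apply: le_trans (_ : (1 + q *+ n) * (1 + q) <= _); last first.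
    by rewrite ler_pM2r//; lra.
  have qn : 0 <= q *+ n by rewrite mulrn_wge0// ltW.
  by rewrite mulrS; have := mulr_ge0 qn (ltW q0); lra.
have b n : q *+ n <= K / x.
  rewrite ler_pdivlMr//; apply: le_trans (_ : (x / y) ^+ n.+1 * x <= _).
    rewrite ler_pM2r//; apply: le_trans (bern n.+1).
    by rewrite mulrS; lra.
  by rewrite expr_div_n mulrAC -exprSr ler_pdivrMr ?exprn_gt0.
have := b (Num.truncn (K / x / q)).+1.
rewrite -mulr_natr -ler_pdivlMl// mulrC leNgt truncnS_gt//.
Qed.

Section Powers.
Context {R : realType} {A : cstarAlgType R}.
Implicit Types h : A.

(* The non-unital power h^(n+1). *)
Definition apow h n : A := iter n (amul h) h.

Lemma apowD h m n : apow h m ** apow h n = apow h (m + n).+1.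
Proof. by elim: m => [|m IH] //; rewrite addSn /apow !iterS -!/(apow h _) -amulA IH. Qed.

Lemma apow_sa h n : star h = h -> star (apow h n) = apow h n.
Proof.
move=> hs; elim: n => [|n IH] //; rewrite /apow iterS -/(apow h n) star_amul hs IH.
by have := apowD h n 0; have := apowD h 0 n; rewrite addn0 add0n => -> ->.
Qed.

Lemma nm_apow_le h n : nm (apow h n) <= nm h ^+ n.+1.
Proof.
elim: n => [|n IH]; first by rewrite expr1.
by apply: le_trans (nm_amul _ _) _; rewrite exprS; apply: ler_wpM2l; rewrite ?nm_ge0.
Qed.

(** The C*-identity makes the norms of powers log-convex: |h^(n+2)|^2 = |h^(2n+4)| <= |h^(n+3)|
    |h^(n+1)|. The ratios of consecutive norms thus never fall below the first one, |h^2| / |h| =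
    |h|. *)
Lemma nm_apow_sa h n : star h = h -> nm h ^+ n.+1 <= nm (apow h n).
Proof.
move=> hs; have [h0|h0] := eqVneq (nm h) 0; first by rewrite h0 expr0n nm_ge0.
have hp : 0 < nm h by rewrite lt_def h0 nm_ge0.
suff [] : nm h ^+ n.+1 <= nm (apow h n) /\ nm h * nm (apow h n) <= nm (apow h n.+1) by [].
elim: n => [|n [IH1 IH2]]; first by rewrite expr1 /= nm_sqr_sa// expr2.
have h1 : nm h ^+ n.+2 <= nm (apow h n.+1).
  by apply: le_trans IH2; rewrite exprS ler_pM2l.
split => //.
have ap : 0 < nm (apow h n) by apply: lt_le_trans IH1; rewrite exprn_gt0.
rewrite -(ler_pM2r ap).
have : nm (apow h n.+1) ^+ 2 <= nm (apow h n.+2) * nm (apow h n).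
  by rewrite -nm_sqr_sa ?apow_sa// apowD -(addSnnS n.+1 n) -apowD nm_amul.
apply: le_trans; rewrite expr2 [leLHS]mulrAC.
by apply: ler_wpM2r; rewrite ?nm_ge0.
Qed.

End Powers.

Section MoreLimits.
Context {R : realType} {C B : cstarAlgType R}.

Lemma lims_nm_mono (u : nat -> C) (w : nat -> B) a b (K : R) : 0 <= K ->
  lims u a -> lims w b -> (forall n, nm (w n) <= K * nm (u n)) -> nm b <= K * nm a.
Proof.
move=> K0 ua wb h; rewrite leNgt; apply/negP => lt.
pose e := (nm b - K * nm a) / (1 + K).
have e0 : 0 < e by rewrite divr_gt0; lra.
have eE : e * (1 + K) = nm b - K * nm a by rewrite mulfVK// gt_eqF; lra.
have [N hN] := ua _ e0; have [M hM] := wb _ e0.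
have {}hN := hN _ (leq_maxl N M); have {}hM := hM _ (leq_maxr N M).
have := h (maxn N M); have := nm_le_dist b (w (maxn N M)).
have := nm_le_dist (u (maxn N M)) a.
rewrite (nmC b); set s := nm (u _) in hN *; move: hN hM.
set d := nm (w _ - b); set d' := nm (u _ - a); set t := nm (w _).
have d'0 : 0 <= d' by exact: nm_ge0.
move=> h1 h2 h3 h4 h5.
have : K * s <= K * (nm a + e) by apply: ler_wpM2l => //; lra.
lra.
Qed.

Lemma lims_amul (u v : nat -> C) x y :
  lims u x -> lims v y -> lims (fun n => u n ** v n) (x ** y).
Proof.
move=> ux vy e e0.
pose K := nm x + nm y + 1.
have K0 : 0 < K by rewrite /K; have := nm_ge0 x; have := nm_ge0 y; lra.
have e1 : 0 < Num.min 1 (e / (2 * K)).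
  by rewrite lt_min ltr01 divr_gt0// mulr_gt0.
have [N hN] := ux _ e1; have [M hM] := vy _ e1.
exists (maxn N M) => n; rewrite geq_max => /andP[/hN {}hN /hM {}hM].
have -> : u n ** v n - x ** y = (u n - x) ** v n + x ** (v n - y).
  by rewrite amulBl amulBr; zmod.
move: hN hM; rewrite !lt_min !ltr_pdivlMr ?mulr_gt0// => /andP[_ hN] /andP[v1 hM].
apply: le_lt_trans (nmD _ _) _.
have vK : nm (v n) <= K by have := nm_le_dist (v n) y; have := nm_ge0 x; rewrite /K; lra.
have xK : nm x <= K by have := nm_ge0 y; rewrite /K; lra.
have b1 : nm ((u n - x) ** v n) <= nm (u n - x) * K.
  by apply: le_trans (nm_amul _ _) _; apply: ler_wpM2l; rewrite ?nm_ge0.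
have b2 : nm (x ** (v n - y)) <= nm (v n - y) * K.
  by apply: le_trans (nm_amul _ _) _; rewrite mulrC; apply: ler_wpM2l; rewrite ?nm_ge0.
lra.
Qed.

End MoreLimits.

Section AssociatedMorphism.
Context {R : realType} {C B : cstarAlgType R} (Z : set C) (f : C -> B).
Hypotheses (hZ : stro Z) (hf : ternary_star_morphism Z f).

Let Z0 : Z 0. Proof. by case: (stro_lin hZ). Qed.
Let ZD x y : Z x -> Z y -> Z (x + y). Proof. exact: linsetD (stro_lin hZ). Qed.
Let ZZ (a : R[i]) x : Z x -> Z (a *: x). Proof. exact: linsetZ (stro_lin hZ). Qed.
Let Zs x : Z x -> Z (star x). Proof. exact: stro_star. Qed.
Let ZT x y z : Z x -> Z y -> Z z -> Z (x ** y ** z). Proof. exact: stroT. Qed.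

(** The graph of pi on the span of products. It is a relation because the sum of the f(x_i) f(y_i)
    might depend on the representation until [good_bound] is known. *)
Inductive good : C -> B -> Prop :=
| good0 : good 0 0
| good_cons (l : R[i]) x y a b of Z x & Z y & good a b :
    good (l *: (x ** y) + a) (l *: (f x ** f y) + b).

Lemma goodL (l : R[i]) a b a' b' :
  good a b -> good a' b' -> good (l *: a + a') (l *: b + b').
Proof.
move=> + g'; elim => [|m x y c d Zx Zy gc IH]; first by rewrite !scaler0 !add0r.
by rewrite !scalerDr !scalerA -!addrA; apply: good_cons.
Qed.

Lemma goodB a b a' b' : good a b -> good a' b' -> good (a - a') (b - b').
Proof.
move=> g g'; have := goodL (-1) g' g; rewrite !scaleN1r.
by rewrite addrC [- b' + b]addrC.
Qed.

Lemma good_gen x y : Z x -> Z y -> good (x ** y) (f x ** f y).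
Proof.
by move=> Zx Zy; have := good_cons 1 Zx Zy good0; rewrite !scale1r !addr0.
Qed.

Lemma good_star a b : good a b -> good (star a) (star b).
Proof.
elim=> [|l x y c d Zx Zy gc IH]; first by rewrite !star0; exact: good0.
rewrite !star_antilinear !star_amul; apply: goodL => //.
by rewrite -!(tmS hf)//; apply: good_gen; exact: Zs.
Qed.

Lemma good_act_l z a b : Z z -> good a b -> Z (z ** a) /\ f (z ** a) = f z ** b.
Proof.
move=> Zz; elim=> [|l x y c d Zx Zy gc [IH1 IH2]].
  by rewrite !amulx0 (tm0 hZ hf).
rewrite !amul_linearr !amulA; split; first by apply: ZD => //; apply: ZZ; exact: ZT.
by rewrite (tmL hf)//; [rewrite (tmT hZ hf)// IH2|exact: ZT].
Qed.

Lemma good_act_r z a b : Z z -> good a b -> Z (a ** z) /\ f (a ** z) = b ** f z.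
Proof.
move=> Zz; elim=> [|l x y c d Zx Zy gc [IH1 IH2]].
  by rewrite !amul0x (tm0 hZ hf).
rewrite !amul_linearl; split; first by apply: ZD => //; apply: ZZ; exact: ZT.
by rewrite (tmL hf)//; [rewrite (tmT hZ hf)// IH2|exact: ZT].
Qed.

Lemma good_mul a b a' b' : good a b -> good a' b' -> good (a ** a') (b ** b').
Proof.
move=> + g'; elim => [|l x y c d Zx Zy gc IH]; first by rewrite !amul0x; exact: good0.
rewrite !amul_linearl; apply: goodL => //; rewrite -!amulA.
by have [Zya <-] := good_act_l Zy g'; exact: good_gen.
Qed.

(** Each term f(x) f(y) b' equals f(x) f(y a') with y a' in [Z], where [tm_bound] applies. [K]
    depends on the chosen representation of [a]. *)
Lemma good_mul_bound a b : good a b ->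
  exists2 K : R, 0 <= K & forall a' b', good a' b' -> nm (b ** b') <= K * nm a'.
Proof.
elim=> [|l x y c d Zx Zy gc [K K0 hK]].
  by exists 0 => // a' b' _; rewrite amul0x nm0 mul0r.
exists (nm l * (nm (f x) * (2 * nm y)) + K) => [|a' b' g'].
  by rewrite addr_ge0// !mulr_ge0 ?nm_ge0.
rewrite amul_linearl mulrDl; apply: le_trans (nmD _ _) _; apply: lerD; last exact: hK.
rewrite nmZ -!mulrA ler_wpM2l ?nm_ge0// -amulA.
have [Zya <-] := good_act_l Zy g'.
apply: le_trans (nm_amul _ _) _; rewrite ler_wpM2l ?nm_ge0//.
apply: le_trans (tm_bound hZ hf Zya) _; rewrite ler_wpM2l// nm_amul//.
Qed.

Lemma good_apow a b n : good a b -> good (apow a n) (apow b n).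
Proof. by move=> g; elim: n => [|n IH] //; exact: good_mul. Qed.

(** For h = b^* b, one factor of h^(n+2) is paid for by the constant [K] and the others by powers of
    a^* a: |h|^(n+2) <= K |a^* a|^(n+1). Letting n grow removes [K]. *)
Lemma good_bound a b : good a b -> nm b <= nm a.
Proof.
move=> g.
rewrite -(@ler_pXn2r _ 2) ?nnegrE ?nm_ge0// -!nm_cstar.
have g2 := good_mul (good_star g) g.
have [K K0 hK] := good_mul_bound g2.
apply: (@le_of_exp_le _ _ _ K); rewrite ?nm_ge0// => n.
have hs : star (star b ** b) = star b ** b by rewrite star_amul starK.
apply: le_trans (nm_apow_sa n.+1 hs) _; rewrite /apow iterS -/(apow _ n).
apply: le_trans (hK _ _ (good_apow n g2)) _.
by rewrite ler_wpM2l// nm_apow_le.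
Qed.

Definition gcl (a : C) (b : B) : Prop := exists u w,
  [/\ forall n, good (u n) (w n), lims u a & lims w b].

Lemma gcl_bound a b : gcl a b -> nm b <= nm a.
Proof.
move=> [u [w [g ua wb]]]; rewrite -[leRHS]mul1r.
by apply: lims_nm_mono ua wb _ => // n; rewrite mul1r; exact: good_bound.
Qed.

Lemma gclL (l : R[i]) a b a' b' : gcl a b -> gcl a' b' -> gcl (l *: a + a') (l *: b + b').
Proof.
move=> [u [w [g ua wb]]] [u' [w' [g' ua' wb']]].
exists (fun n => l *: u n + u' n), (fun n => l *: w n + w' n); split.
- by move=> n; exact: goodL.
- by apply: limsD => //; exact: limsZ.
- by apply: limsD => //; exact: limsZ.
Qed.

Lemma gcl_fun a b b' : gcl a b -> gcl a b' -> b = b'.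
Proof.
move=> g g'; apply/esym/subr0_eq/nm_eq0/eqP; rewrite eq_le nm_ge0 andbT.
have := gclL (-1) g g'; rewrite !scaleN1r addNr addrC => /gcl_bound.
by rewrite nm0.
Qed.

Lemma gcl_star a b : gcl a b -> gcl (star a) (star b).
Proof.
move=> [u [w [g ua wb]]]; exists (fun n => star (u n)), (fun n => star (w n)); split.
- by move=> n; exact: good_star.
- exact: lims_star.
- exact: lims_star.
Qed.

Lemma gclM a b a' b' : gcl a b -> gcl a' b' -> gcl (a ** a') (b ** b').
Proof.
move=> [u [w [g ua wb]]] [u' [w' [g' ua' wb']]].
exists (fun n => u n ** u' n), (fun n => w n ** w' n); split.
- by move=> n; exact: good_mul.
- exact: lims_amul.
- exact: lims_amul.
Qed.

Lemma gcl_good a b : good a b -> gcl a b.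
Proof. by move=> g; exists (fun=> a), (fun=> b); split => //; exact: lims_cst. Qed.

Lemma gcl_ex a : sqset Z a -> exists b, gcl a b.
Proof.
move=> /closure_lims[u uS ua].
have ex n : exists b, good (u n) b.
  apply: (@span_min _ _ _ [set a | exists b, good a b]) (uS n).
    split; first by exists 0; exact: good0.
    by move=> l x y [b gb] [b' gb']; exists (l *: b + b'); exact: goodL.
  by move=> _ [x Zx [y Zy <-]]; exists (f x ** f y); exact: good_gen.
have [w hw] := choice ex.
have [|b wb] := @complete_lims _ B w.
  move=> e /(lims_cauchys ua)[N hN]; exists N => m n Nm Nn.
  by apply: le_lt_trans (hN _ _ Nm Nn); apply: good_bound; exact: goodB.
by exists b, u, w.
Qed.

Definition assoc_hom (a : C) : B := xget 0 [set b | gcl a b].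

Lemma assoc_homP a : sqset Z a -> gcl a (assoc_hom a).
Proof. by move=> /gcl_ex[b gb]; apply: (xgetPex 0 (P := [set b | gcl a b])); exists b. Qed.

Lemma assoc_hom_eq a b : gcl a b -> assoc_hom a = b.
Proof.
move=> g; apply: (gcl_fun _ g).
by apply: (xgetPex 0 (P := [set b | gcl a b])); exists b.
Qed.

Lemma assoc_hom_gen x y : Z x -> Z y -> assoc_hom (x ** y) = f x ** f y.
Proof. by move=> Zx Zy; apply: assoc_hom_eq; apply: gcl_good; exact: good_gen. Qed.

Lemma assoc_hom_star_hom : star_hom (sqset Z) assoc_hom.
Proof.
split; [split|].
- by move=> l a b /assoc_homP ga /assoc_homP gb; apply: assoc_hom_eq; exact: gclL.
- by move=> a /assoc_homP ga; apply: assoc_hom_eq; exact: gcl_star.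
- by move=> a b /assoc_homP ga /assoc_homP gb; apply: assoc_hom_eq; exact: gclM.
Qed.

Lemma assoc_hom_act_l z a : Z z -> sqset Z a -> f (z ** a) = f z ** assoc_hom a.
Proof.
move=> Zz sa; have [u [w [g ua wb]]] := assoc_homP sa.
have Zza : Z (z ** a) by exact: stro_mul_sq.
have h := fun n => good_act_l Zz (g n).
apply: lims_unique (tm_lims hZ hf (fun n => (h n).1) Zza (lims_amul_r z ua)) _.
by apply: lims_ext (lims_amul_r (f z) wb) => n /=; rewrite (h n).2.
Qed.

Lemma assoc_hom_act_r z a : Z z -> sqset Z a -> f (a ** z) = assoc_hom a ** f z.
Proof.
move=> Zz sa; have [u [w [g ua wb]]] := assoc_homP sa.
have Zza : Z (a ** z) by exact: sq_mul_stro.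
have h := fun n => good_act_r Zz (g n).
apply: lims_unique (tm_lims hZ hf (fun n => (h n).1) Zza (lims_amul_l z ua)) _.
by apply: lims_ext (lims_amul_l (f z) wb) => n /=; rewrite (h n).2.
Qed.

End AssociatedMorphism.

Section StarHomExtension.
Context {R : realType} {C B : cstarAlgType R} (Z : set C).
Hypothesis hZ : stro Z.

Lemma sq_stro : stro (sqset Z).
Proof.
by apply: subalg_stro; [exact: sq_closed|exact: sq_lin|exact: sq_star|exact: sqM].
Qed.

(* *-homomorphisms of a closed *-algebra are automatically continuous. *)
Lemma star_hom_sq_eq (p q : C -> B) :
  star_hom (sqset Z) p -> star_hom (sqset Z) q ->
  (forall x y, Z x -> Z y -> p (x ** y) = q (x ** y)) ->
  forall a, sqset Z a -> p a = q a.
Proof.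
move=> hp hq h.
have tp : ternary_star_morphism (sqset Z) p.
  by apply: star_hom_ternary hp; [exact: sq_star|exact: sqM].
have tq : ternary_star_morphism (sqset Z) q.
  by apply: star_hom_ternary hq; [exact: sq_star|exact: sqM].
move=> a sa; have [u uS ua] := closure_lims sa.
have su n : sqset Z (u n) by apply: subset_closure.
apply: lims_unique (tm_lims sq_stro tp su sa ua) _.
apply: lims_ext (tm_lims sq_stro tq su sa ua) => n /=; apply/esym.
suff [] : sqset Z (u n) /\ p (u n) = q (u n) by [].
apply: (@span_min _ _ _ [set a | sqset Z a /\ p a = q a]) (uS n).
  split; first by split; [case: (sq_lin Z)|rewrite (tm0 sq_stro tp) (tm0 sq_stro tq)].
  move=> l x y [sx ex] [sy ey]; split; first by case: (sq_lin Z) => _; apply.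
  by rewrite hp.1.1// hq.1.1// ex ey.
by move=> _ [x Zx [y Zy <-]]; split; [exact: sq_mul|exact: h].
Qed.

End StarHomExtension.

(** * Agreement of f and pi on J(Z) *)

Section PositiveTernary.
Context {R : realType} {C B : cstarAlgType R} (Z : set C) (f : C -> B).
Hypotheses (hZ : stro Z) (hf : ternary_star_morphism Z f)
  (hpos : forall x, Z x -> pos x -> pos (f x)).

(** With r = p - q one has r (p + q) = 0, so the positive elements r p r and r q r add up to 0 and
    both vanish. Hence p r = q r = 0 and r^2 = 0. *)
Lemma pos_sqr_inj (p q : B) : pos p -> pos q -> p ** q = q ** p ->
  p ** p = q ** q -> p = q.
Proof.
move=> pp pq c e; pose r := p - q.
have rs : star r = r by rewrite starB !pos_sa.
have kill (s : B) : pos s -> star r ** s ** r = 0 -> s ** r = 0.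
  move=> [y ->]; rewrite rs => h.
  have : y ** r = 0 by apply: cstar0; rewrite star_amul rs -h !amulA.
  by move=> yr; rewrite -amulA yr amulx0.
have sum0 : star r ** p ** r + star r ** q ** r = 0.
  rewrite -amulDl -amulDr rs (_ : r ** (p + q) = 0) ?amul0x//.
  by rewrite amulBl !amulDr e c; zmod.
have pr : p ** r = 0 by apply: kill => //; exact: pos_eq0 (pos_conj _ pp) (pos_conj _ pq) sum0.
have qr : q ** r = 0.
  by apply: kill => //; rewrite addrC in sum0; exact: pos_eq0 (pos_conj _ pq) (pos_conj _ pp) sum0.
by apply/subr0_eq/amul_sa0 => //; rewrite -/r amulBl pr qr subrr.
Qed.

Local Notation pi := (assoc_hom Z f).

Let piM a b : sqset Z a -> sqset Z b -> pi (a ** b) = pi a ** pi b.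
Proof. by case: (assoc_hom_star_hom hZ hf) => _; apply. Qed.

Let piS a : sqset Z a -> pi (star a) = star (pi a).
Proof. by case: (assoc_hom_star_hom hZ hf) => -[_ + _]; apply. Qed.

Let piL (l : R[i]) a b : sqset Z a -> sqset Z b -> pi (l *: a + b) = l *: pi a + pi b.
Proof. by case: (assoc_hom_star_hom hZ hf) => -[+ _ _]; apply. Qed.

(** For a = x^2, both f(a) pi(a) and pi(a) f(a) are f(a^2), and both squares are pi(a^2). Positivity
    of f(a) is what [hpos] contributes. *)
Let tm_eq_assoc_sqr x : Z x -> sqset Z x -> star x = x -> f (x ** x) = pi (x ** x).
Proof.
move=> Zx sx xs; set a := x ** x.
have Za : Z a by exact: stro_mul_sq.
have sa : sqset Z a by exact: sq_mul.
have as_ : star a = a by rewrite star_amul xs.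
apply: pos_sqr_inj.
- by apply: hpos => //; exists x; rewrite xs.
- by exists (pi x); rewrite -piS// -piM// xs.
- by rewrite -(assoc_hom_act_l hZ hf)// -(assoc_hom_act_r hZ hf).
- by rewrite -piM// -(assoc_hom_gen hZ hf).
Qed.

Lemma tm_eq_assoc x : Z x -> sqset Z x -> f x = pi x.
Proof.
have sa_case u : Z u -> sqset Z u -> star u = u -> f u = pi u.
  move=> Zu su us; apply/subr0_eq/amul_sa0.
    by rewrite starB -piS// -(tmS hf)// us.
  (* The four terms of (f(u) - pi(u))^2 are pi(u^2), f(u^2), f(u^2) and pi(u^2), with alternating
     signs that cancel once f(u^2) = pi(u^2). *)
  rewrite amulBl !amulBr -(assoc_hom_act_l hZ hf)// -(assoc_hom_act_r hZ hf)//.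
  by rewrite tm_eq_assoc_sqr// -piM// -(assoc_hom_gen hZ hf)//; zmod.
move=> Zx sx; have [u [v [us vs xE uE vE]]] := sa_decomp x.
have lin (S : set C) : linset S -> S x -> S (star x) -> S u /\ S v.
  move=> lS Sx Ss; rewrite uE vE; split; apply: linsetZ => //.
    exact: linsetD.
  exact: linsetB.
have [Zu Zv] := lin _ (stro_lin hZ) Zx (stro_star hZ Zx).
have [su sv] := lin _ (sq_lin Z) sx (sq_star hZ sx).
by rewrite xE addrC (tmL hf)// piL// !sa_case.
Qed.

End PositiveTernary.

(** * The extension to Z + Z^2 *)

Section SumAlgebra.
Context {R : realType} {C : cstarAlgType R} (Z : set C).
Hypothesis hZ : stro Z.
Local Notation A := (addset Z (sqset Z)).

Let lZ := stro_lin hZ.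
Let lS := sq_lin Z.

Lemma addset_intro z b : Z z -> sqset Z b -> A (z + b).
Proof. by move=> Zz sb; exists z => //; exists b. Qed.

Lemma sub_addset_l z : Z z -> A z.
Proof. by move=> Zz; rewrite -[z]addr0; apply: addset_intro => //; case: lS. Qed.

Lemma addset_lin : linset A.
Proof.
split; first by apply: sub_addset_l; case: lZ.
move=> l _ _ [z Zz [b sb <-]] [z' Zz' [b' sb' <-]].
rewrite scalerDr addrACA; apply: addset_intro.
  by case: lZ => _; apply.
by case: lS => _; apply.
Qed.

Lemma addset_star a : A a -> A (star a).
Proof.
move=> [z Zz [b sb <-]]; rewrite starD; apply: addset_intro.
  exact: stro_star.
exact: sq_star.
Qed.

(** Grouped by degree: mixed products fall in [Z], the others in Z^2. *)
Lemma addset_mulE (z b z' b' : C) :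
  (z + b) ** (z' + b') = (z ** b' + b ** z') + (z ** z' + b ** b').
Proof. by rewrite amulDl !amulDr; zmod. Qed.

Lemma addsetM x y : A x -> A y -> A (x ** y).
Proof.
move=> [z Zz [b sb <-]] [z' Zz' [b' sb' <-]]; rewrite addset_mulE.
apply: addset_intro.
  by apply: (linsetD lZ); [exact: stro_mul_sq|exact: sq_mul_stro].
by apply: (linsetD lS); [exact: sq_mul|exact: sqM].
Qed.

(* A is the image of the C*-algebra of matrices [[b, z], [z, b]] under the
   *-homomorphism [[b, z], [z, b]] |-> z + b, and such images are closed. *)
Lemma addset_closed : closed A.
Proof.
pose i0 : 'I_2 := ord0; pose i1 : 'I_2 := ord_max.
pose G : set (cmat C 2) := [set X | [/\ sqset Z (X i0 i0), Z (X i0 i1),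
  X i1 i0 = X i0 i1 & X i1 i1 = X i0 i0]].
pose g (X : cmat C 2) := X i0 i1 + X i0 i0.
have entry (u : nat -> cmat C 2) X i j : lims u X -> lims (fun n => u n i j) (X i j).
  apply: (@lims_lip _ _ _ (fun Y : cmat C 2 => Y i j) 1) => n; rewrite mul1r.
  by have := nm_entry (u n - X) i j; rewrite !mxE.
have sum2 (F : 'I_2 -> C) : \sum_i F i = F i0 + F i1.
  by rewrite big_ord_recl big_ord1; congr (_ + F _); exact: val_inj.
have mulE (X Y : cmat C 2) i j : (X ** Y) i j = X i i0 ** Y i0 j + X i i1 ** Y i1 j.
  by rewrite mxE sum2.
have cG : closed G.
  apply/closedP => X hX.
  have /closure_lims[u uG uX] : closure G X by apply/closureP.
  split.
  - by apply: (closed_lims (@sq_closed _ _ Z) _ (entry u X i0 i0 uX)) => n; case: (uG n).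
  - by apply: (closed_lims (stro_closed hZ) _ (entry u X i0 i1 uX)) => n; case: (uG n).
  - apply: (lims_unique (entry u X i1 i0 uX)).
    by apply: lims_ext (entry u X i0 i1 uX) => n; case: (uG n).
  - apply: (lims_unique (entry u X i1 i1 uX)).
    by apply: lims_ext (entry u X i0 i0 uX) => n; case: (uG n).
have lG : linset G.
  split; first by split; rewrite !mxE//; [case: lS|case: lZ].
  move=> a X Y [x1 x2 x3 x4] [y1 y2 y3 y4]; split; rewrite !mxE ?x3 ?x4 ?y3 ?y4//.
    by case: lS => _; apply.
  by case: lZ => _; apply.
have sG X : G X -> G (star X).
  move=> [x1 x2 x3 x4]; split; rewrite !mxE ?x3 ?x4//; first exact: sq_star.
  exact: stro_star.
have mG X Y : G X -> G Y -> G (X ** Y).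
  move=> [x1 x2 x3 x4] [y1 y2 y3 y4]; split; rewrite !mulE ?x3 ?x4 ?y3 ?y4.
  - by apply: (linsetD lS); [exact: sqM|exact: sq_mul].
  - by apply: (linsetD lZ); [exact: sq_mul_stro|exact: stro_mul_sq].
  - by rewrite addrC.
  - by rewrite addrC.
have gh : star_hom G g.
  split; [split|].
  - by move=> a X Y _ _; rewrite /g !mxE scalerDr; zmod.
  - by move=> X [_ _ x3 _]; rewrite /g !mxE x3 starD.
  - move=> X Y [_ _ x3 x4] [_ _ y3 y4].
    by rewrite /g !mulE y3 y4 !(amulDl, amulDr); zmod.
have -> : A = g @` G.
  apply/seteqP; split=> [_ [z Zz [b sb <-]]|_ [X [x1 x2 _ _] <-]]; last exact: addset_intro.
  exists (\matrix_(i, j) (if i == j then b else z)); last by rewrite /g !mxE.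
  by split; rewrite !mxE.
apply: closed_image; first exact: subalg_stro.
exact: star_hom_ternary gh.
Qed.

Lemma addset_subalg : subalg A.
Proof.
by split; [exact: addset_closed|case: addset_lin|case: addset_lin|exact: addsetM].
Qed.

End SumAlgebra.

Section Extension.
Context {R : realType} {C B : cstarAlgType R} (Z : set C) (f : C -> B).
Hypotheses (hZ : stro Z) (hf : ternary_star_morphism Z f)
  (hpos : forall x, Z x -> pos x -> pos (f x)).
Local Notation A := (addset Z (sqset Z)).
Local Notation pi := (assoc_hom Z f).

Let lZ := stro_lin hZ.
Let lS := sq_lin Z.
Let pih := assoc_hom_star_hom hZ hf.

Definition ext_hom (a : C) : B :=
  xget 0 [set w | exists z b, [/\ Z z, sqset Z b, a = z + b & w = f z + pi b]].

Let pi0 : pi 0 = 0.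
Proof.
have [S0 _] := lS.
have := pih.1.1 (-1) _ _ S0 S0.
by rewrite scaler0 addr0 scaleN1r addNr.
Qed.

(** Two decompositions of an element differ by z - z' = b' - b, an element of J(Z), where f and pi
    agree. *)
Lemma ext_homE z b : Z z -> sqset Z b -> ext_hom (z + b) = f z + pi b.
Proof.
move=> Zz sb; rewrite /ext_hom.
have [z' [b' [Zz' sb' e ->]]] := @xgetPex _ 0
  [set w | exists z' b', [/\ Z z', sqset Z b', z + b = z' + b' & w = f z' + pi b']]
  (ex_intro _ (f z + pi b) (ex_intro _ z (ex_intro _ b (And4 Zz sb erefl erefl)))).
have e' : z - z' = b' - b.
  have -> : z - z' = (z + b) - z' - b by zmod.
  by rewrite e; zmod.
have ff : f (z - z') = pi (b' - b).
  rewrite -e'; apply: (tm_eq_assoc hZ hf hpos); first exact: linsetB lZ Zz Zz'.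
  by rewrite e'; exact: linsetB lS sb' sb.
rewrite (tmB hf)// in ff.
have pB : pi (b' - b) = pi b' - pi b.
  by have := pih.1.1 (-1) _ _ sb sb'; rewrite !scaleN1r addrC [RHS]addrC.
rewrite pB in ff; have -> : f z = f z - f z' + f z' by rewrite subrK.
by rewrite ff; zmod.
Qed.

Lemma ext_hom_star_hom : star_hom A ext_hom.
Proof.
split; [split|].
- move=> l _ _ [z Zz [b sb <-]] [z' Zz' [b' sb' <-]].
  rewrite scalerDr addrACA !ext_homE//; last 2 first.
  + by case: lZ => _; apply.
  + by case: lS => _; apply.
  by rewrite (tmL hf)// pih.1.1// scalerDr addrACA.
- move=> _ [z Zz [b sb <-]]; rewrite starD !ext_homE//.
  + by rewrite (tmS hf)// pih.1.2// starD.
  + exact: stro_star.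
  + exact: sq_star.
- move=> _ _ [z Zz [b sb <-]] [z' Zz' [b' sb' <-]].
  have Z1 : Z (z ** b') by exact: stro_mul_sq.
  have Z2 : Z (b ** z') by exact: sq_mul_stro.
  have s1 : sqset Z (z ** z') by exact: sq_mul.
  have s2 : sqset Z (b ** b') by exact: sqM.
  rewrite addset_mulE !ext_homE//; [|exact: linsetD lZ Z1 Z2|exact: linsetD lS s1 s2].
  rewrite addset_mulE (tmD hf)// (assoc_hom_act_l hZ hf)// (assoc_hom_act_r hZ hf)//.
  congr (_ + _); rewrite -(assoc_hom_gen hZ hf)// -pih.2//.
  by have := pih.1.1 1 _ _ s1 s2; rewrite !scale1r.
Qed.

Lemma ext_hom_l z : Z z -> ext_hom z = f z.
Proof.
move=> Zz; rewrite -[in LHS](addr0 z) ext_homE//; last by case: lS.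
by rewrite pi0 addr0.
Qed.

(* A positive matrix over Z is the square of a matrix over A, to which the
   extension of f applies. *)
Lemma pos_tm_cp : completely_positive_map Z f.
Proof.
split; first by case: hf.
move=> n X ZX; rewrite matposP => Xp.
have [Y [AY Ys YY]] := pos_sqrt Xp (subalg_cmat (addset_subalg hZ))
  (fun i j => sub_addset_l (ZX i j)).
have [[eL eS] eM] := ext_hom_star_hom.
have e0 : ext_hom 0 = 0.
  by rewrite ext_hom_l ?(tm0 hZ hf)//; case: lZ.
exists (map_mx ext_hom Y); apply/matrixP => i j.
rewrite !mxE -(ext_hom_l (ZX i j)) -[in LHS]YY !mxE.
have -> : ext_hom (\sum_k Y i k ** Y k j) = \sum_k ext_hom (Y i k ** Y k j).
  suff [] : A (\sum_k Y i k ** Y k j) /\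
    ext_hom (\sum_k Y i k ** Y k j) = \sum_k ext_hom (Y i k ** Y k j) by [].
  apply: (big_rec2 (fun x y => A x /\ ext_hom x = y)).
    by split => //; case: (addset_lin hZ).
  move=> k x y _ [Ay <-].
  have AYY : A (Y i k ** Y k j) by apply: addsetM.
  split; first exact: linsetD (addset_lin hZ) AYY Ay.
  by have := eL 1 _ _ AYY Ay; rewrite !scale1r.
apply: eq_bigr => k _; rewrite eM// !mxE; congr (_ ** _).
rewrite -[in LHS]Ys mxE eS//.
Qed.

End Extension.

(** * C*-subalgebras and unitizations *)

Definition cstar_subalg {R : realType} {C : cstarAlgType R} (D : set C) : Prop :=
  [/\ closed D, linset D, forall x, D x -> D (star x)
    & forall x y, D x -> D y -> D (x ** y)].

(** The proof [hD] is a parameter of the type, so that the operations declared on it can refer to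
    the closure properties of [D]. *)
Definition csub (R : realType) (C : cstarAlgType R) (D : set C)
  (hD : cstar_subalg D) : Type := {x : C | x \in D}.

Section Subalgebra.
Context {R : realType} {C : cstarAlgType R} (D : set C) (hD : cstar_subalg D).
Local Notation S := (csub hD).
Implicit Types u v w : S.

HB.instance Definition _ := Choice.copy S {x : C | x \in D}.

Let lD : linset D. Proof. by case: hD. Qed.

Definition csub_mk x (Dx : D x) : S := exist _ x (mem_set Dx).

Lemma csubP u : D (val u).
Proof. by apply: set_mem; exact: (valP u). Qed.

Definition szero : S := csub_mk lD.1.
Definition sadd u v : S := csub_mk (linsetD lD (csubP u) (csubP v)).
Definition sopp u : S := csub_mk (linsetN lD (csubP u)).
Definition sscale (a : R[i]) u : S := csub_mk (linsetZ a lD (csubP u)).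
Definition smul u v : S :=
  csub_mk (let: And4 _ _ _ h := hD in h _ _ (csubP u) (csubP v)).
Definition sstar u : S := csub_mk (let: And4 _ _ h _ := hD in h _ (csubP u)).

Let saddA : associative sadd.
Proof. by move=> u v w; apply: val_inj; exact: addrA. Qed.
Let saddC : commutative sadd.
Proof. by move=> u v; apply: val_inj; exact: addrC. Qed.
Let sadd0 : left_id szero sadd.
Proof. by move=> u; apply: val_inj; exact: add0r. Qed.
Let saddN : left_inverse szero sopp sadd.
Proof. by move=> u; apply: val_inj; exact: addNr. Qed.

HB.instance Definition _ := GRing.isZmodule.Build S saddA saddC sadd0 saddN.

Let sscaleA (a b : R[i]) u : sscale a (sscale b u) = sscale (a * b) u.
Proof. by apply: val_inj; exact: scalerA. Qed.
Let sscale1 : left_id 1 sscale.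
Proof. by move=> u; apply: val_inj; exact: scale1r. Qed.
Let sscaleDr : right_distributive sscale +%R.
Proof. by move=> a u v; apply: val_inj; exact: scalerDr. Qed.
Let sscaleDl u : {morph sscale^~ u : a b / a + b}.
Proof. by move=> a b; apply: val_inj; exact: scalerDl. Qed.

HB.instance Definition _ := GRing.Zmodule_isLmodule.Build R[i] S
  sscaleA sscale1 sscaleDr sscaleDl.

Let snorm u : R := nm (val u).

Let snormD u v : snorm (u + v) <= snorm u + snorm v.
Proof. exact: nmD. Qed.
Let snormZ (a : R[i]) u : snorm (a *: u) = nm a * snorm u.
Proof. exact: nmZ. Qed.
Let snorm_eq0 u : snorm u = 0 -> u = 0.
Proof. by move=> /nm_eq0 h; exact: val_inj. Qed.
Let snorm_complete (s : nat -> S) :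
  (forall e : R, 0 < e -> exists N, forall m n, (N <= m)%N -> (N <= n)%N ->
     snorm (s m - s n) < e) ->
  exists l, forall e : R, 0 < e -> exists N, forall n, (N <= n)%N ->
     snorm (s n - l) < e.
Proof.
move=> hs; have [x hx] := @complete_lims _ C (fun n => val (s n)) hs.
have Dx : D x by apply: closed_lims _ _ hx => [|n]; [case: hD|exact: csubP].
by exists (csub_mk Dx).
Qed.
Let smulA : associative smul.
Proof. by move=> u v w; apply: val_inj; exact: amulA. Qed.
Let smul_linearl (a : R[i]) u v w : smul (a *: u + v) w = a *: smul u w + smul v w.
Proof. by apply: val_inj; exact: amul_linearl. Qed.
Let smul_linearr (a : R[i]) u v w : smul u (a *: v + w) = a *: smul u v + smul u w.
Proof. by apply: val_inj; exact: amul_linearr. Qed.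
Let sstarK : involutive sstar.
Proof. by move=> u; apply: val_inj; exact: starK. Qed.
Let sstar_antilinear (a : R[i]) u v : sstar (a *: u + v) = a^*%R *: sstar u + sstar v.
Proof. by apply: val_inj; exact: star_antilinear. Qed.
Let sstar_mul u v : sstar (smul u v) = smul (sstar v) (sstar u).
Proof. by apply: val_inj; exact: star_amul. Qed.
Let snorm_mul u v : snorm (smul u v) <= snorm u * snorm v.
Proof. exact: nm_amul. Qed.
Let snorm_cstar u : snorm (smul (sstar u) u) = snorm u ^+ 2.
Proof. exact: nm_cstar. Qed.

HB.instance Definition _ := Lmodule_isCStarAlgebra.Build R S
  snormD snormZ snorm_eq0 snorm_complete smulA smul_linearl smul_linearr
  sstarK sstar_antilinear sstar_mul snorm_mul snorm_cstar.

Definition csub_iota (x : C) : unitz S :=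
  if pselect (D x) is left Dx then uiota (csub_mk Dx) else 0.

Lemma csub_iotaE x (Dx : D x) : csub_iota x = uiota (csub_mk Dx).
Proof.
rewrite /csub_iota; case: pselect => // Dx'.
by congr uiota; apply: val_inj.
Qed.

Lemma csub_iota_unitization : is_unitization D (1 : unitz S) csub_iota.
Proof.
have [_ _ sD mD] := hD.
split.
- by move=> u; split; [exact: mul1r|exact: mulr1].
- split; [split|].
  + move=> a x y Dx Dy; rewrite (csub_iotaE Dx) (csub_iotaE Dy).
    rewrite (csub_iotaE (linsetD lD (linsetZ a lD Dx) Dy)) -uiotaZ -uiotaD.
    by congr uiota; apply: val_inj.
  + move=> x Dx; rewrite (csub_iotaE Dx) (csub_iotaE (sD _ Dx)) -uiota_star.
    by congr uiota; apply: val_inj.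
  + move=> x y Dx Dy; rewrite (csub_iotaE Dx) (csub_iotaE Dy).
    rewrite (csub_iotaE (mD _ _ Dx Dy)); apply: etrans (uiotaM _ _).
    by congr uiota; apply: val_inj.
- move=> x y; rewrite !inE => Dx Dy; rewrite (csub_iotaE Dx) (csub_iotaE Dy).
  by move=> /uiota_inj[].
- move=> [a l]; exists (val a); first exact: csubP.
  exists l; rewrite (csub_iotaE (csubP a)).
  have -> : csub_mk (csubP a) = a by exact: val_inj.
  congr pair; first by rewrite /= scaler0 addr0.
  by rewrite /= add0r; apply/esym/mulr1.
- move=> [x Dx]; rewrite (csub_iotaE Dx) => /(congr1 snd) /= /esym/eqP.
  by rewrite oner_eq0.
Qed.

End Subalgebra.

Section UnitizationFunctor.
Context {R : realType} {B : cstarAlgType R}.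

Lemma uiota_unitization : is_unitization [set: B] (1 : unitz B) uiota.
Proof.
split.
- by move=> u; split; [exact: mul1r|exact: mulr1].
- split; [split|].
  + by move=> a x y _ _; rewrite uiotaD uiotaZ.
  + by move=> x _; exact: uiota_star.
  + by move=> x y _ _; exact: uiotaM.
- by move=> x y _ _; exact: uiota_inj.
- move=> [a l]; exists a => //; exists l.
  congr pair; first by rewrite /= scaler0 addr0.
  by rewrite /= add0r; apply/esym/mulr1.
- by move=> [x _] /(congr1 snd) /= /esym/eqP; rewrite oner_eq0.
Qed.

Lemma unitz_map (S : cstarAlgType R) (g : S -> B) : star_hom [set: S] g ->
  let T (u : unitz S) : unitz B := (g u.1, u.2) in
  [/\ star_hom [set: unitz S] T, T 1 = 1 & forall a, T (uiota a) = uiota (g a)].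
Proof.
move=> [[gL gS] gM] T.
have gZ (a : R[i]) x : g (a *: x) = a *: g x.
  have g0 : g 0 = 0 by have := gL (-1) 0 0 I I; rewrite scaler0 addr0 scaleN1r addNr.
  by have := gL a x 0 I I; rewrite g0 !addr0.
have gD x y : g (x + y) = g x + g y by have := gL 1 x y I I; rewrite !scale1r.
split => //.
- split; [split|].
  + move=> a x y _ _; rewrite /T; congr pair; exact: gL.
  + move=> x _; rewrite /T; congr pair; exact: gS.
  + move=> x y _ _; rewrite /T; congr pair.
    by rewrite /= !gD !gZ gM.
- by rewrite /T; congr pair => /=; have := gZ 0 0; rewrite !scale0r.
Qed.

End UnitizationFunctor.

(** * Inverses of the extensions *)

Section Inverses.
Context {R : realType} {C B : cstarAlgType R}.

Lemma assoc_hom_sq (Z : set C) (f : C -> B) (W : set B) a :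
  stro Z -> ternary_star_morphism Z f -> (forall x, Z x -> W (f x)) ->
  sqset Z a -> sqset W (assoc_hom Z f a).
Proof.
move=> hZ hf fW sa; have [u [w [g ua wb]]] := assoc_homP hZ hf sa.
apply: closed_lims (@sq_closed _ _ W) _ wb => n.
elim: (g n) => [|l x y c d Zx Zy _ IH]; first by case: (sq_lin W).
case: (sq_lin W) => _; apply => //; apply: sub_cspan.
by exists (f x); [exact: fW|exists (f y) => //; exact: fW].
Qed.

(** On Z^2 the composite of the two associated *-homomorphisms fixes the products x y, so
    [star_hom_sq_eq] identifies it with [id]. The lemma is applied twice, the second time with [f]
    and [g] exchanged. *)
Lemma ext_hom_cancel (Z : set C) (W : set B) (f : C -> B) (g : B -> C) :
  stro Z -> stro W ->
  ternary_star_morphism Z f -> ternary_star_morphism W g ->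
  (forall x, Z x -> pos x -> pos (f x)) -> (forall x, W x -> pos x -> pos (g x)) ->
  (forall x, Z x -> W (f x)) -> (forall x, Z x -> g (f x) = x) ->
  forall a, addset Z (sqset Z) a ->
    addset W (sqset W) (ext_hom Z f a) /\ ext_hom W g (ext_hom Z f a) = a.
Proof.
move=> hZ hW hf hg pf pg fW gf _ [z Zz [b sb <-]].
have sW : sqset W (assoc_hom Z f b) by exact: assoc_hom_sq.
rewrite (ext_homE hZ hf pf)//; split; first by apply: addset_intro => //; exact: fW.
rewrite (ext_homE hW hg pg)//; last exact: fW.
rewrite gf//; congr (_ + _).
have [[fL fS] fM] := assoc_hom_star_hom hZ hf.
have [[gL gS] gM] := assoc_hom_star_hom hW hg.
have sub c : sqset Z c -> sqset W (assoc_hom Z f c) by exact: assoc_hom_sq.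
apply: (@star_hom_sq_eq _ _ _ _ hZ (fun c => assoc_hom W g (assoc_hom Z f c)) id) sb.
- split; [split|] => [l x y sx sy|x sx|x y sx sy].
  + by rewrite fL// gL//; exact: sub.
  + by rewrite fS// gS//; exact: sub.
  + by rewrite fM// gM//; exact: sub.
- by [].
- move=> x y Zx Zy; rewrite (assoc_hom_gen hZ hf)// (assoc_hom_gen hW hg) ?gf//; exact: fW.
Qed.

End Inverses.

Theorem corollary4p3 (R : realType) (C B : cstarAlgType R)
    (Z : set C) (theta : C -> B)
    (hZ : is_starTRO Z)
    (hternary : ternary_star_morphism Z theta)
    (hpos : positive_map Z theta) :
  [/\
    (* 1 *)
    completely_positive_map Z theta,
    (* 2 *)
    star_hom (JTRO Z) theta /\
    (exists pi : C -> B,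
      [/\ star_hom (sqset Z) pi,
          forall x y, Z x -> Z y ->
            pi (star x ** y) = star (theta x) ** theta y,
          forall pi' : C -> B, star_hom (sqset Z) pi' ->
            (forall x y, Z x -> Z y ->
              pi' (star x ** y) = star (theta x) ** theta y) ->
            forall a, sqset Z a -> pi' a = pi a
        & forall a, JTRO Z a -> theta a = pi a]),
    (* 3 *)
    (exists rho : C -> B,
      [/\ star_hom (addset Z (sqset Z)) rho,
          forall z, Z z -> rho z = theta z
        & exists (U V : cstarAlgType R) (eU : U) (eV : V)
                 (iota : C -> U) (kappa : B -> V) (Theta : U -> V),
          [/\ is_unitization (addset Z (sqset Z)) eU iota,
              is_unitization [set: B] eV kappa,
              star_hom [set: U] Theta,
              Theta eU = eV
            & forall a, addset Z (sqset Z) a ->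
                Theta (iota a) = kappa (rho a)]])
  & (* 4 *)
    (order_embedding Z theta ->
      let W := theta @` Z in
      [/\ complete_order_embedding Z theta,
          is_starTRO W,
          star_iso (JTRO Z) (JTRO W) theta
        & exists rho : C -> B,
            star_iso (addset Z (sqset Z)) (addset W (sqset W)) rho /\
            (forall z, Z z -> rho z = theta z)])].
Proof.
have {}hZ : stro Z by apply/is_starTROP.
have [_ ptheta] := hpos.
pose pi := assoc_hom Z theta.
have pih : star_hom (sqset Z) pi := assoc_hom_star_hom hZ hternary.
have Jhom : star_hom (JTRO Z) theta.
  split; [split|].
  - by move=> a x y [Zx _] [Zy _]; exact: (tmL hternary).
  - by move=> x [Zx _]; exact: (tmS hternary).
  (* theta(x y) = theta(x) pi(y) for x in [Z] and y in Z^2, and pi(y) = theta(y) when y lies in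
     J(Z). *)
  - move=> x y [Zx _] [Zy sy].
    by rewrite (assoc_hom_act_l hZ hternary)// (tm_eq_assoc hZ hternary ptheta Zy).
have rhoh := ext_hom_star_hom hZ hternary ptheta.
have rhoZ z : Z z -> ext_hom Z theta z = theta z.
  exact: (ext_hom_l hZ hternary ptheta).
have cp := pos_tm_cp hZ hternary ptheta.
split => //.
- split => //; exists pi; split => //.
  + move=> x y Zx Zy; rewrite /pi (assoc_hom_gen hZ hternary)//; last exact: stro_star.
    by rewrite (tmS hternary).
  + move=> pi' hpi' gen; apply: (star_hom_sq_eq hZ hpi' pih) => x y Zx Zy.
    have Zsx := stro_star hZ Zx.
    have := gen _ _ Zsx Zy; rewrite starK => ->.
    by rewrite (tmS hternary)// starK /pi (assoc_hom_gen hZ hternary).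
  + by move=> a [Za sa]; exact: (tm_eq_assoc hZ hternary ptheta).
- exists (ext_hom Z theta); split => //.
  (* The subset Z + Z^2 becomes a type of its own, to which [unitz] applies. *)
  have hA : cstar_subalg (addset Z (sqset Z)).
    split; [exact: addset_closed|exact: addset_lin|exact: addset_star|exact: addsetM].
  have rh : star_hom [set: csub hA] (fun a => ext_hom Z theta (val a)).
    split; [split|] => [a x y _ _|x _|x y _ _].
    - exact: (rhoh.1.1 _ _ _ (csubP x) (csubP y)).
    - exact: (rhoh.1.2 _ (csubP x)).
    - exact: (rhoh.2 _ _ (csubP x) (csubP y)).
  have [T1 T2 T3] := unitz_map rh.
  exists (unitz (csub hA)), (unitz B), 1, 1, (csub_iota hA), uiota,
    (fun u => (ext_hom Z theta (val u.1), u.2)); split => //.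
  + exact: csub_iota_unitization.
  + exact: uiota_unitization.
  + by move=> a Aa; rewrite (csub_iotaE hA Aa).
- move=> [inj _ [g gt [[gL gS] gpos]]] W.
  have hW : stro W.
    split; first exact: closed_image hZ hternary.
    + split; first by exists 0; [case: (stro_lin hZ)|exact: (tm0 hZ hternary)].
      move=> a _ _ [x Zx <-] [y Zy <-]; exists (a *: x + y); last exact: (tmL hternary).
      by case: (stro_lin hZ) => _; apply.
    + move=> _ [x Zx <-]; exists (star x); last exact: (tmS hternary).
      exact: stro_star.
    + move=> _ _ _ [x Zx <-] [y Zy <-] [z Zz <-]; exists (x ** y ** z).
        exact: stroT.
      exact: (tmT hZ hternary).
  (* The inverse is again ternary, and it is positive by assumption, so all results on [theta] also
     hold for [g] on [W]. *)
  have hg : ternary_star_morphism W g.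
    split => // _ _ _ [x Zx <-] [y Zy <-] [z Zz <-].
    rewrite !gt// -hternary.2// gt//; apply: stroT => //; exact: stro_star.
  have thW x : Z x -> W (theta x) by move=> Zx; exists x.
  have gZ y : W y -> Z (g y) by move=> [x Zx <-]; rewrite gt.
  have tg y : W y -> theta (g y) = y by move=> [x Zx <-]; rewrite gt.
  have canZ := ext_hom_cancel hZ hW hternary hg ptheta gpos thW gt.
  have canW := ext_hom_cancel hW hZ hg hternary gpos ptheta gZ tg.
  split.
  + split => //; exists g => //; exact: pos_tm_cp hW hg gpos.
  + exact/is_starTROP.
  + split => //; split.
    * move=> x [Zx sx]; split; first exact: thW.
      rewrite (tm_eq_assoc hZ hternary ptheta Zx sx).
      exact: assoc_hom_sq hZ hternary thW sx.
    * move=> x y; rewrite !inE => -[Zx _] [Zy _] h.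
      by rewrite -(gt _ Zx) h gt.
    (* The preimage lies in Z^2 because [g] agrees on J(W) with its associated *-homomorphism, which
       maps W^2 into Z^2. *)
    * move=> y [Wy sy]; exists (g y); last exact: tg.
      split; first exact: gZ.
      rewrite (tm_eq_assoc hW hg gpos Wy sy).
      exact: assoc_hom_sq hW hg gZ sy.
  + exists (ext_hom Z theta); split => //; split => //; split.
    * by move=> a /canZ[].
    * move=> a b; rewrite !inE => /canZ[_ ha] /canZ[_ hb] h.
      by rewrite -ha h hb.
    * by move=> w /canW[h1 h2]; exists (ext_hom W g w).
Qed.
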